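(* Let $T>0$, and let $f$ be a $C^1$ solution on $[0,T]\times\mathbb{R}^2$ of the one-dimensional Vlasov-Poisson system $$\partial_t f + v\,\partial_x f - E\,\partial_v f = 0,\qquad \rho(t,x)=\int_{\mathbb{R}} (F(v)-f(t,x,v))\,dv,$$ $$E(t,x)=\frac12\left(\int_{-\infty}^x \rho(t,y)\,dy-\int_x^\infty \rho(t,y)\,dy\right),\qquad f(0,x,v)=f_0(x,v).$$ Assume that: (I) there is $R>0$ such that $f_0(x,v)=F(v)$ for all $|x|>R$ and all $v\in\mathbb{R}$, where $F\in C^1_c(\mathbb{R})$ is even and nonnegative, and $f_0\in C^1(\mathbb{R}^2)$ is nonnegative and compactly supported in $v$, i.e. there is $P>0$ with $f_0(x,v)=0$ for all $x\in\mathbb{R}$ and all $|v|>P$; (II) there is $C^{(1)}>0$ such that $\int_0^T\|E(\tau)\|_\infty\,d\tau\le C^{(1)}$. Let $R(t)$ be as defined in the context, and set $$E^0=\frac12\int_{-R}^R\int_{\mathbb{R}}(F(v)-f_0(y,v))\,dv\,dy,\qquad \omega=\left(\int_{\mathbb{R}}F(v)\,dv\right)^{1/2}.$$ Then for every $t\in[0,T]$, every $x\in\mathbb{R}$ with $|x|>R(t)$, and every $v\in\mathbb{R}$, $$E(t,x)=E^0\,\mathrm{sign}(x)\cos(\omega t)$$ and $$f(t,x,v)=F\left(v+\frac{E^0\,\mathrm{sign}(x)}{\omega}\sin(\omega t)\right),$$ where, in the degenerate case $F\equiv 0$ (so $\omega=0$), the quotient $\sin(\omega t)/\omega$ is read as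 $t$.
   Context: Given functions are $F:\mathbb{R}\to[0,\infty)$ and $f_0:\mathbb{R}^2\to[0,\infty)$; the unknowns are $f:[0,T]\times\mathbb{R}\times\mathbb{R}\to\mathbb{R}$ and $E:[0,T]\times\mathbb{R}\to\mathbb{R}$. Here $t$ is time, $x$ is space, $v$ is momentum, and $\|E(\tau)\|_\infty=\sup_{x\in\mathbb{R}}|E(\tau,x)|$. A solution means that all relations of the system hold (in particular the integrals defining $\rho$ and $E$ make sense). $\mathrm{sign}(x)=1$ for $x\ge0$ and $\mathrm{sign}(x)=-1$ for $x<0$. Put $g(t,x,v)=F(v)-f(t,x,v)$ and, for $t\in[0,T]$, $$Q_g(t)=\sup\{|v| : \exists\, x\in\mathbb{R},\ \tau\in[0,t]\text{ such that } g(\tau,x,v)\neq 0\}$$ (a supremum of a subset of $[0,\infty)$, equal to $0$ if the set is empty), and, with $R$ the constant of assumption (I), $$R(t)=R+tQ_g(t)+\int_0^t\int_\tau^t\|E(s)\|_\infty\,ds\,d\tau.$$ *)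

(* Defs.v *)
From HB Require Import structures.
From mathcomp Require Import all_boot all_order all_algebra.
From mathcomp Require Import all_classical all_reals all_analysis.

Set Implicit Arguments.
Unset Strict Implicit.
Unset Printing Implicit Defensive.

Import Order.TTheory GRing.Theory Num.Theory.
Import numFieldNormedType.Exports.

Local Open Scope classical_set_scope.
Local Open Scope ring_scope.

(* One-dimensional Vlasov-Poisson system, stated over MathComp-Analysis, with
   Lebesgue integrals.  Functions of t : [0, T] are total functions on R whose
   values outside [0, T] are never used. *)

Section VlasovPoisson.
Context {R : realType}.
Local Notation mu := (@lebesgue_measure R).

(* Unlike Num.sg, this takes the value 1 at 0. *)
Definition VP_sign (x : R) : R := if 0 <= x then 1 else -1.

Definition compactly_supported (F : R -> R) : Prop :=
  compact (closure [set v | F v != 0]).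

Definition C1 (F : R -> R) : Prop :=
  (forall v : R, derivable F v 1) /\ continuous (derive1 F).

Definition C1_plane (h : R -> R -> R) : Prop :=
  [/\ (forall x v : R, derivable (h ^~ v) x 1),
      (forall x v : R, derivable (h x) v 1),
      continuous (fun p : R * R => derive1 (h ^~ p.2) p.1) &
      continuous (fun p : R * R => derive1 (h p.1) p.2)].

(* Derivative relative to A: only values of u on A matter.  For A = [a, b] it is
   one-sided at the endpoints. *)
Definition is_derive_within (A : set R) (u : R -> R) (x l : R) : Prop :=
  (u y - u x) / (y - x) @[y --> within A x^'] --> l.

Definition slab (T : R) : set (R * R * R) := [set p | 0 <= p.1.1 <= T].

(* f is C^1 on the closed slab [0, T] x R x R, with partial derivatives
   ft, fx, fv. *)
Record C1_slab (T : R) (f ft fx fv : R -> R -> R -> R) : Prop := {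
  C1_slab_t : forall t x v : R, 0 <= t <= T ->
    is_derive_within `[0, T] (fun s => f s x v) t (ft t x v) ;
  C1_slab_x : forall t x v : R, 0 <= t <= T ->
    is_derive x 1 (fun y : R => f t y v) (fx t x v) ;
  C1_slab_v : forall t x v : R, 0 <= t <= T ->
    is_derive v 1 (fun w : R => f t x w) (fv t x v) ;
  C1_slab_cont :
    {within slab T, continuous (fun p : R * R * R => f p.1.1 p.1.2 p.2)} ;
  C1_slab_cont_t :
    {within slab T, continuous (fun p : R * R * R => ft p.1.1 p.1.2 p.2)} ;
  C1_slab_cont_x :
    {within slab T, continuous (fun p : R * R * R => fx p.1.1 p.1.2 p.2)} ;
  C1_slab_cont_v :
    {within slab T, continuous (fun p : R * R * R => fv p.1.1 p.1.2 p.2)} }.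

Definition VP_rho (F : R -> R) (f : R -> R -> R -> R) (t x : R) : R :=
  \int[mu]_v (F v - f t x v).

(* The integrability clauses express that the integrals defining VP_rho and E
   make sense (Rintegral is total).  No regularity of E is assumed. *)
Definition VP_solution (T : R) (F : R -> R) (f0 : R -> R -> R)
    (f : R -> R -> R -> R) (E : R -> R -> R) : Prop :=
  (exists ft fx fv : R -> R -> R -> R,
    C1_slab T f ft fx fv /\
    forall t x v : R, 0 <= t <= T ->
      ft t x v + v * fx t x v - E t x * fv t x v = 0) /\
  [/\ forall t x : R, 0 <= t <= T ->
        mu.-integrable setT (fun v => (F v - f t x v)%:E),
      forall t : R, 0 <= t <= T ->
        mu.-integrable setT (fun y => (VP_rho F f t y)%:E),
      forall t x : R, 0 <= t <= T ->
        E t x = 2^-1 * (\int[mu]_(y in `]-oo, x]) VP_rho F f t y -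
                        \int[mu]_(y in `[x, +oo[) VP_rho F f t y) &
      forall x v : R, f 0 x v = f0 x v].

Definition supnorm (u : R -> R) : \bar R :=
  ereal_sup [set `|u x|%:E | x in [set: R]].

(* The maximum with 0 makes the supremum of the empty set 0 (ereal_sup set0 is
   -oo); the value is +oo when the set is unbounded. *)
Definition Qg (F : R -> R) (f : R -> R -> R -> R) (t : R) : \bar R :=
  maxe 0%E (ereal_sup [set `|v|%:E | v in
    [set v | exists x tau, 0 <= tau <= t /\ F v - f tau x v != 0]]).

(* +oo when t > 0 and Qg F f t = +oo; then no x exceeds it. *)
Definition VP_radius (R0 : R) (F : R -> R) (f : R -> R -> R -> R)
    (E : R -> R -> R) (t : R) : \bar R :=
  (R0%:E + t%:E * Qg F f t +
   \int[mu]_(tau in `[0%R, t]) \int[mu]_(s in `[tau, t]) supnorm (E s))%E.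

Definition VP_E0 (R0 : R) (F : R -> R) (f0 : R -> R -> R) : R :=
  2^-1 * \int[mu]_(y in `[- R0, R0]) \int[mu]_v (F v - f0 y v).

Definition VP_omega (F : R -> R) : R := Num.sqrt (\int[mu]_v F v).

(* sin (w t) / w, extended by its limit t at w = 0. *)
Definition sinq (w t : R) : R := if w == 0 then t else sin (w * t) / w.

End VlasovPoisson.

(* Main.v *)
Require Import Defs.
From mathcomp Require Import all_boot all_order all_algebra.
From mathcomp Require Import all_classical all_reals all_analysis.
From mathcomp Require Import ring lra.

Set Implicit Arguments.
Unset Strict Implicit.
Unset Printing Implicit Defensive.

Import Order.TTheory GRing.Theory Num.Theory.
Import numFieldNormedType.Exports.

Local Open Scope classical_set_scope.
Local Open Scope ring_scope.

(** At t = 0 the claim is read off the initial data ([field_initial]).  At a time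
    t > 0 and a point x with |x| > R(t), the speed bound Q_g(t) is finite and one
    can pick Q > Q_g(t) with |x| > R + t Q; up to time t, f = F for all |v| >= Q.
    If F'(u) <> 0 for some |u| > Q_g(t), the Vlasov equation at velocity u reduces
    to E F'(u) = 0, so E vanishes and f is transported freely ([field_vanishes],
    [free_transport]).  Otherwise F and f both vanish for |v| >= Q
    ([background_supp]), nothing moves faster than Q, and this is the situation
    recorded in [confined_solution].

    Characteristics would require some regularity of E in time.  They are
    replaced by a maximum principle on trapezoids a + Q s < x < b - Q s
    ([transport_max_principle]), which evaluates the equation at a single point
    only.

    The core is a Gronwall argument in the x direction ([lipschitz_halving]).
    Integrating the Vlasov equation over v and over a segment gives conservation
    of charge,
      d/ds (E(s, y) - E(s, x)) = p(s, y) - p(s, x),  p = \int v f dv.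
    Hence a bound |f(s, y, v) - f(s, x, v)| <= k e^(l s) (y - x) yields a
    Lipschitz bound of order k / l for E, and then, by the maximum principle
    applied to translates of f, a bound of order k / l^2 for f.  For l large the
    constant k is halved, so it is 0: over a base [a, b] on which f_0 = F,
    neither f nor E depends on x inside the trapezoid, and the density vanishes
    there.

    Outside the cone |x| <= R + Q s the field is therefore +-e(s), with e(s) half
    of the total charge.  Its derivative is half of the difference of the momenta
    p at +-r, and testing the Vlasov equation against v gives p' = -w^2 E there,
    because f carries the same mass w^2 = \int F as the background
    ([momentum_rate_outside]).  So e'' = -w^2 e with e'(0) = 0, that is
    e(s) = E^0 cos(w s) ([field_oscillates]).  Knowing E, the shifted profile
    F(v +- E^0 sin(w s) / w) solves the same transport equation with the same
    initial value, and the maximum principle identifies it with f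
    ([distribution_oscillates]). *)

(** * Continuous functions and integrals over segments *)

Section Calculus.
Context {R : realType}.
Local Notation mu := (@lebesgue_measure R).
Implicit Types (a b : R).

Lemma continuous_comp2 (T : topologicalType) (k : R -> R -> R) (p q : T -> R) :
  continuous (fun z : R * R => k z.1 z.2) -> continuous p -> continuous q ->
  continuous (fun z => k (p z) (q z)).
Proof.
move=> ck cp cq z.
apply: (@continuous_comp _ _ _ (fun z => (p z, q z)) (fun z : R * R => k z.1 z.2)).
  exact: (cvg_pair (cp z) (cq z)).
exact: ck.
Qed.

Lemma continuous_comp3 (T : topologicalType) (k : R -> R -> R -> R)
    (p q r : T -> R) :
  continuous (fun z : R * R * R => k z.1.1 z.1.2 z.2) ->
  continuous p -> continuous q -> continuous r ->
  continuous (fun z => k (p z) (q z) (r z)).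
Proof.
move=> ck cp cq cr z.
apply: (@continuous_comp _ _ _ (fun z => (p z, q z, r z))
  (fun z : R * R * R => k z.1.1 z.1.2 z.2)).
  exact: (cvg_pair (cvg_pair (cp z) (cq z)) (cr z)).
exact: ck.
Qed.

Lemma is_derive_continuous (u u' : R -> R) :
  (forall s : R, is_derive s 1 u (u' s)) -> continuous u.
Proof.
by move=> du s; apply/differentiable_continuous/derivable1_diffP/ex_derive; exact: du.
Qed.

Lemma continuous_integrable_itv (g : R -> R) a b :
  continuous g -> mu.-integrable `[a, b] (EFin \o g).
Proof.
move=> cg; apply: continuous_compact_integrable; first exact: segment_compact.
exact: continuous_subspaceT.
Qed.

Lemma norm_Rintegral_itv_le (g : R -> R) a b (M : R) : continuous g -> a <= b ->
  (forall v, a <= v <= b -> `|g v| <= M) ->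
  `|\int[mu]_(v in `[a, b]) g v| <= M * (b - a).
Proof.
move=> cg ab gM.
apply: (le_trans (le_normr_Rintegral _ _)) => //.
  exact: continuous_integrable_itv.
have -> : M * (b - a) = \int[mu]_(v in `[a, b]) M.
  rewrite Rintegral_cst//= lebesgue_measure_itv/= lte_fin.
  by case: ltgtP ab => //= -> _; rewrite subrr.
apply: le_Rintegral => //.
- apply: (@continuous_integrable_itv (fun v => `|g v|)).
  by move=> v; apply: cvg_norm; exact: cg.
- by apply: (@continuous_integrable_itv (fun=> M)) => v; exact: cvg_cst.
Qed.

Lemma Rintegral_derive (G g : R -> R) a b : continuous g -> a <= b ->
  (forall x : R, is_derive x 1 G (g x)) ->
  \int[mu]_(x in `[a, b]) g x = G b - G a.
Proof.
move=> cg; rewrite le_eqVlt => /predU1P[<- _|ab dG].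
  by rewrite subrr set_itv1 Rintegral_set1.
have cG : continuous G by exact: is_derive_continuous dG.
rewrite /Rintegral (@continuous_FTC2 _ g G)//.
- exact: continuous_subspaceT.
- split.
  + by move=> x _; apply: ex_derive; exact: dG.
  + by apply: cvg_at_right_filter; exact: cG.
  + by apply: cvg_at_left_filter; exact: cG.
- by move=> x _; rewrite derive1E; apply: derive_val; exact: dG.
Qed.

(** Tube lemma: joint continuity is uniform along the compact segment. *)
Lemma continuous_near_itv (T : topologicalType) (k : T -> R -> R) a b (p0 : T)
    (e : R) :
  continuous (fun z : T * R => k z.1 z.2) -> 0 < e ->
  \forall p \near p0, forall v, a <= v <= b -> `|k p v - k p0 v| < e.
Proof.
move=> ck e0.
have /compact_near_coveringP/(_ _ (nbhs p0)
  (fun p v => `|k p v - k p0 v| < e)) := @segment_compact R a b.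
move=> H; have {}H : \forall p \near p0, `[a, b] `<=` [set v | `|k p v - k p0 v| < e].
  apply: H => v _.
  pose d (z : R * T) : R := k z.2 z.1 - k p0 z.1.
  have cd : {for (v, p0), continuous d}.
    apply: (@continuousB _ R^o _ (fun z : R * T => k z.2 z.1) (fun z : R * T => k p0 z.1)).
      apply: (@continuous_comp _ _ _ (fun z : R * T => (z.2, z.1)) (fun z : T * R => k z.1 z.2)).
        exact: (cvg_pair cvg_snd cvg_fst).
      exact: ck.
    apply: (@continuous_comp _ _ _ (fun z : R * T => (p0, z.1)) (fun z : T * R => k z.1 z.2)).
      exact: (cvg_pair (cvg_cst _) cvg_fst).
    exact: ck.
  have d0 : d (v, p0) = 0 by rewrite /d subrr.
  have /cvgrPdist_lt/(_ _ e0) := cd.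
  by apply: filterS => -[x q]; rewrite d0 sub0r normrN.
by apply: filterS H => p Hp v abv; apply: Hp; rewrite /= in_itv.
Qed.

Lemma continuous_param (T : topologicalType) (k : T -> R -> R) (p : T) :
  continuous (fun z : T * R => k z.1 z.2) -> continuous (k p).
Proof.
move=> ck v.
apply: (@continuous_comp _ _ _ (fun v : R => (p, v)) (fun z : T * R => k z.1 z.2)).
  exact: (cvg_pair (cvg_cst _) cvg_id).
exact: ck.
Qed.

Lemma continuous_Rintegral_param (T : topologicalType) (k : T -> R -> R) a b :
  a <= b -> continuous (fun z : T * R => k z.1 z.2) ->
  continuous (fun p => \int[mu]_(v in `[a, b]) k p v).
Proof.
move=> ab ck p0; apply/cvgrPdist_le => e e0.
pose e' := e / (b - a + 1).
have ba0 : 0 < b - a + 1 by lra.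
have e'0 : 0 < e' by rewrite divr_gt0.
near=> p; rewrite -RintegralB//; last 2 first.
- by apply: continuous_integrable_itv; exact: continuous_param.
- by apply: continuous_integrable_itv; exact: continuous_param.
apply: (@le_trans _ _ (e' * (b - a))).
  apply: norm_Rintegral_itv_le => //.
    by move=> v; apply: (@continuousB _ R^o); exact: continuous_param.
  move=> v abv; rewrite distrC ltW//; move: v abv.
  by near: p; exact: continuous_near_itv.
rewrite /e' mulrAC ler_pdivrMr//.
by rewrite ler_wpM2l ?ltW//; lra.
Unshelve. all: by end_near. Qed.

Lemma is_derive_Rintegral_param (k k' : R -> R -> R) a b (s : R) : a <= b ->
  (forall s v : R, is_derive s 1 (k ^~ v) (k' s v)) ->
  (forall s, continuous (k s)) ->
  continuous (fun z : R * R => k' z.1 z.2) ->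
  is_derive s 1 (fun s => \int[mu]_(v in `[a, b]) k s v)
    (\int[mu]_(v in `[a, b]) k' s v).
Proof.
move=> ab dk ck ck'.
pose I : set R := [set` `](s - 1), (s + 1)[%R].
have Is : I s by rewrite /I/= in_itv/=; apply/andP; split; lra.
have [M HM] : exists M : R, forall x v : R, s - 1 <= x <= s + 1 -> a <= v <= b -> `|k' x v| <= M.
  have cK : compact ([set` `[s - 1, s + 1]%R] `*` [set` `[a, b]%R]).
    by apply: compact_setX; exact: segment_compact.
  have [||/= c _ Hc] := @compact_EVT_max _ R (fun z : R * R => `|k' z.1 z.2|) _ _ cK.
  - by exists (s, a); split => /=; rewrite in_itv/= ?lexx//; apply/andP; split; lra.
  - by apply: continuous_subspaceT => z; apply: cvg_norm; exact: ck'.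
  exists (`|k' c.1 c.2|) => x v sx av.
  by apply: (Hc (x, v)); rewrite inE; split => /=; rewrite in_itv.
have d1 x v : partial1of2 k x v = k' x v.
  by rewrite /partial1of2 derive1E; apply: derive_val; exact: dk.
have intf (x : R) : I x -> mu.-integrable `[a, b] (EFin \o k x).
  by move=> _; exact: continuous_integrable_itv.
have derf (x v : R) : I x -> [set` `[a, b]%R] v -> derivable (k ^~ v) x 1.
  by move=> _ _; apply: ex_derive; exact: dk.
have M0 (v : R) : 0 <= Num.max M 0 by rewrite le_max lexx orbT.
have iM : mu.-integrable `[a, b] (EFin \o (fun _ : R => Num.max M 0)).
  by apply: (@continuous_integrable_itv (fun=> _)) => v; exact: cvg_cst.
have GM (x v : R) : I x -> [set` `[a, b]%R] v -> `|partial1of2 k x v| <= Num.max M 0.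
  rewrite /I/= !in_itv/= => /andP[x1 x2] abv.
  by rewrite d1 le_max HM//; apply/andP; split; exact: ltW.
have mab := @measurable_itv R `[a, b]%R.
apply: DeriveDef.
  exact: (@derivable_under_integral R _ _ mu k _ mab _ _ _ Is intf derf _ M0 iM GM).
rewrite -derive1E (@differentiation_under_integral R _ _ mu k _ mab _ _ _ Is intf derf _ M0 iM GM).
by apply: eq_Rintegral => v _; rewrite d1.
Qed.

End Calculus.

Section Continuity3.
Context {R : realType}.

Lemma continuous_coord1 : continuous (fun z : R * R * R => z.1.1).
Proof.
by move=> z; apply: (@continuous_comp _ _ _ (fun z : R * R * R => z.1)
  (fun z : R * R => z.1)); exact: cvg_fst.
Qed.

Lemma continuous_coord2 : continuous (fun z : R * R * R => z.1.2).
Proof.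
by move=> z; apply: (@continuous_comp _ _ _ (fun z : R * R * R => z.1)
  (fun z : R * R => z.2)); [exact: cvg_fst|exact: cvg_snd].
Qed.

Lemma continuous_coord3 : continuous (fun z : R * R * R => z.2).
Proof. by move=> z; exact: cvg_snd. Qed.

Lemma continuous_cst {T : topologicalType} (c : R) : continuous (fun _ : T => c).
Proof. by move=> z; exact: cvg_cst. Qed.

Lemma continuous_add {T : topologicalType} (g h : T -> R) :
  continuous g -> continuous h -> continuous (fun z => g z + h z).
Proof. by move=> cg ch z; exact: (@cvgD _ R^o _ _ _ g h _ _ (cg z) (ch z)). Qed.

Lemma continuous_sub {T : topologicalType} (g h : T -> R) :
  continuous g -> continuous h -> continuous (fun z => g z - h z).
Proof. by move=> cg ch z; exact: (@cvgB _ R^o _ _ _ g h _ _ (cg z) (ch z)). Qed.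

Lemma continuous_mul {T : topologicalType} (g h : T -> R) :
  continuous g -> continuous h -> continuous (fun z => g z * h z).
Proof. by move=> cg ch z; exact: (@cvgM R _ _ _ g h _ _ (cg z) (ch z)). Qed.

End Continuity3.

Lemma le0_of_halving {R : realType} (d C : R) :
  (forall n, d <= C / 2 ^+ n) -> d <= 0.
Proof.
move=> H; rewrite leNgt; apply/negP => d0.
have C0 : 0 < C by have := H 0%N; rewrite expr0 divr1; exact: lt_le_trans.
pose n := Num.bound (C / d).
have nC : C / d < n%:R by apply: archi_boundP; rewrite divr_ge0// ltW.
have := H n; rewrite leNgt => /negP; apply.
rewrite ltr_pdivrMr ?exprn_gt0// mulrC -ltr_pdivrMr//.
apply: (lt_trans nC); rewrite -natrX ltr_nat; exact: ltn_expl.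
Qed.

Lemma bounded_on_box {R : realType} (g : R -> R -> R -> R) (a1 b1 a2 b2 a3 b3 : R) :
  continuous (fun z : R * R * R => g z.1.1 z.1.2 z.2) ->
  exists2 M, 0 <= M & forall s x v, a1 <= s <= b1 -> a2 <= x <= b2 -> a3 <= v <= b3 ->
    `|g s x v| <= M.
Proof.
move=> cg.
pose K := [set` `[a1, b1]] `*` [set` `[a2, b2]] `*` [set` `[a3, b3]].
have cK : compact K.
  by apply: compact_setX; [apply: compact_setX|]; exact: segment_compact.
have cG : continuous (fun z : R * R * R => `|g z.1.1 z.1.2 z.2|).
  by move=> z; apply: cvg_norm; exact: cg.
have [K0|/set0P K0] := eqVneq K set0.
  exists 0 => // s x v hs hx hv; exfalso.
  have : K (s, x, v) by split; [split|]; rewrite /= in_itv.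
  by rewrite K0.
have [z _ Hz] := compact_EVT_max K0 cK (continuous_subspaceT cG).
exists `|g z.1.1 z.1.2 z.2| => // s x v hs hx hv.
by apply: (Hz (s, x, v)); rewrite inE; split; [split|]; rewrite /= in_itv.
Qed.

(** * Derivatives of real functions *)

Section Calculus2.
Context {R : realType}.

Lemma is_derive1_eq (u : R -> R) (s l l' : R) : is_derive s 1 u l -> l = l' ->
  is_derive s 1 u l'.
Proof. by move=> ? <-. Qed.

Lemma is_derive1_add (u w : R -> R) (s l m : R) : is_derive s 1 u l ->
  is_derive s 1 w m -> is_derive s 1 (fun z => u z + w z) (l + m).
Proof. by move=> du dw; exact: (@is_deriveD _ _ _ u w s 1 l m du dw). Qed.

Lemma is_derive1_opp (u : R -> R) (s l : R) : is_derive s 1 u l ->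
  is_derive s 1 (fun z => - u z) (- l).
Proof. by move=> du; exact: (@is_deriveN _ _ _ u s 1 l du). Qed.

Lemma is_derive1_sub (u w : R -> R) (s l m : R) : is_derive s 1 u l ->
  is_derive s 1 w m -> is_derive s 1 (fun z => u z - w z) (l - m).
Proof. by move=> du dw; apply: is_derive1_add => //; exact: is_derive1_opp. Qed.

Lemma is_derive1_mul (u w : R -> R) (s l m : R) : is_derive s 1 u l ->
  is_derive s 1 w m -> is_derive s 1 (fun z => u z * w z) (l * w s + u s * m).
Proof.
move=> du dw; apply: is_derive1_eq (@is_deriveM _ _ u w s 1 l m du dw) _.
by rewrite addrC; congr (_ + _); rewrite mulrC.
Qed.

Lemma is_derive1_const (c s : R) : is_derive s 1 (fun=> c) 0.
Proof. exact: is_derive_cst. Qed.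

Lemma is_derive1_idfun (s : R) : is_derive s 1 (fun z : R => z) 1.
Proof. exact: is_derive_id. Qed.

Lemma is_derive1_scale (c : R) (u : R -> R) (s l : R) : is_derive s 1 u l ->
  is_derive s 1 (fun z => c * u z) (c * l).
Proof.
move=> du; apply: is_derive1_eq (is_derive1_mul (is_derive1_const c s) du) _.
by rewrite mul0r add0r.
Qed.

Lemma is_derive1_chain (u w : R -> R) (s l m : R) : is_derive s 1 w m ->
  is_derive (w s) 1 u l -> is_derive s 1 (fun z => u (w z)) (l * m).
Proof. by move=> dw du; exact: (@is_derive1_comp _ u w s l m). Qed.

(** Only times before s are compared with s, so that the lemma applies at the
    last instant of a time interval as well as inside it. *)
Lemma derive_ge0_left_max (u : R -> R) (s l c : R) : is_derive s 1 u l -> c < s ->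
  (forall z, c <= z <= s -> u z <= u s) -> 0 <= l.
Proof.
move=> /is_derive1_caratheodory[g [ug cg <-]] cs umax.
rewrite leNgt; apply/negP => gs0.
have : \forall z \near s, g z < 0 by exact: (cvgr_lt (g s)) cg _ gs0.
move=> /nbhs_ballP[e /= e0 He].
pose z := Num.max c (s - e / 2).
have zs : z < s by rewrite /z gt_max cs/=; lra.
have cz : c <= z by rewrite /z le_max lexx.
have ez : s - e / 2 <= z by rewrite /z le_max lexx orbT.
have /umax : c <= z <= s by rewrite cz ltW.
have gz : g z < 0.
  by apply: He; rewrite /ball/= ger0_norm; lra.
rewrite -subr_le0 ug nmulr_rle0// => ?; lra.
Qed.

Lemma derive_le0_right_max (u : R -> R) (s l c : R) : is_derive s 1 u l -> s < c ->
  (forall z, s <= z <= c -> u z <= u s) -> l <= 0.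
Proof.
move=> du sc umax; rewrite -oppr_ge0.
have dN : is_derive (- s) 1 (fun z : R => - z) (- 1) by apply: is_derive1_opp; exact: is_derive1_idfun.
have du' : is_derive (- - s) 1 u l by rewrite opprK.
apply: (@derive_ge0_left_max (fun z => u (- z)) (- s) (- l) (- c)).
- by apply: is_derive1_eq (is_derive1_chain dN du') _; rewrite mulrN1.
- by rewrite ltrN2.
- by move=> z /andP[z1 z2]; rewrite opprK; apply: umax; apply/andP; split; lra.
Qed.

Lemma derive_cst_itv (u : R -> R) (s l c d : R) : is_derive s 1 u l -> c < d ->
  c <= s <= d -> (forall z, c <= z <= d -> u z = u s) -> l = 0.
Proof.
move=> du cd /andP[cs sd] ucst.
have du' := is_derive1_opp du.
apply/eqP; rewrite eq_le; have [cs'|{}cs] := leP s c.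
  have {cs'}cs : c = s by apply/eqP; rewrite eq_le cs.
  subst c.
  apply/andP; split.
    by apply: derive_le0_right_max du cd _ => z zs; rewrite ucst.
  rewrite -oppr_le0.
  by apply: derive_le0_right_max du' cd _ => z zs; rewrite ucst.
have zz z : c <= z <= s -> u z = u s.
  by move=> /andP[? ?]; apply: ucst; apply/andP; split; lra.
apply/andP; split.
  rewrite -oppr_ge0.
  by apply: derive_ge0_left_max du' cs _ => z zs; rewrite zz.
by apply: derive_ge0_left_max du cs _ => z zs; rewrite zz.
Qed.

Lemma derive_le_increment (u u' w w' : R -> R) (a b : R) : a <= b ->
  (forall s : R, is_derive s 1 u (u' s)) ->
  (forall s : R, is_derive s 1 w (w' s)) ->
  (forall s, a <= s <= b -> u' s <= w' s) -> u b - u a <= w b - w a.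
Proof.
move=> ab du dw uw.
have d (s : R) : is_derive s 1 (fun s => u s - w s) (u' s - w' s) by exact: is_derive1_sub.
have [|c + H] := @MVT_segment R _ (fun s => u' s - w' s) a b ab (fun x _ => d x).
  by apply: continuous_subspaceT; exact: (is_derive_continuous d).
rewrite in_itv/= => /uw cab.
have : (u' c - w' c) * (b - a) <= 0.
  by apply: mulr_le0_ge0; rewrite ?subr_le0 ?subr_ge0.
by rewrite -H; lra.
Qed.

Lemma derive0_cst_itv (u u' : R -> R) (a b : R) :
  (forall s : R, is_derive s 1 u (u' s)) ->
  (forall s, a <= s <= b -> u' s = 0) -> forall s, a <= s <= b -> u s = u a.
Proof.
move=> du u0 s /andP[as_ sb].
have u0' z : a <= z <= s -> u' z = 0.
  by move=> /andP[? ?]; apply: u0; apply/andP; split; lra.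
have d0 (z : R) : is_derive z 1 (fun=> 0 : R) 0 by exact: is_derive1_const.
have h1 := derive_le_increment (w' := fun=> 0) as_ du d0.
have h2 := derive_le_increment (u' := fun=> 0) as_ d0 du.
apply/eqP; rewrite -subr_eq0 eq_le -[X in _ <= X](subrr (0:R)) h1/=.
  rewrite -(subrr (0:R)) h2// => z /u0' ->; exact: lexx.
by move=> z /u0' ->; exact: lexx.
Qed.

End Calculus2.

Lemma is_derive_expR_linear {R : realType} (l z : R) :
  is_derive z 1 (fun r => expR (l * r)) (l * expR (l * z)).
Proof.
apply: is_derive1_eq (is_derive1_chain (u := expR)
  (is_derive1_scale l (is_derive1_idfun z)) (is_derive_expR _)) _.
by rewrite mulr1 mulrC.
Qed.

Lemma sinq0 {R : realType} (w : R) : sinq w 0 = 0.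
Proof. by rewrite /sinq; case: ifP => // _; rewrite mulr0 sin0 mul0r. Qed.

Lemma is_derive_sinq {R : realType} (w s : R) : is_derive s 1 (sinq w) (cos (w * s)).
Proof.
have [->|w0] := eqVneq w 0.
  rewrite (_ : sinq 0 = fun z => z); last by apply/funext => z; rewrite /sinq eqxx.
  by rewrite mul0r cos0; exact: is_derive1_idfun.
rewrite (_ : sinq w = fun z => w^-1 * sin (w * z)); last first.
  by apply/funext => z; rewrite /sinq (negbTE w0) mulrC.
apply: is_derive1_eq (is_derive1_scale w^-1 (is_derive1_chain (u := sin)
  (is_derive1_scale w (is_derive1_idfun s)) (is_derive_sin _))) _.
by field.
Qed.

(** e' = q and q' = - w^2 e need to hold on [0, t] only, so global uniqueness
    theorems do not apply.  The energy w^2 d^2 + r^2 of the difference (d, r)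
    with the explicit solution is constant; this also covers w = 0, where first
    r and then d' vanish. *)
Lemma oscillator {R : realType} (t w : R) (e e' q q' : R -> R) :
  (forall s : R, is_derive s 1 e (e' s)) ->
  (forall s : R, is_derive s 1 q (q' s)) ->
  (forall s, 0 <= s <= t -> e' s = q s) ->
  (forall s, 0 <= s <= t -> q' s = - w ^+ 2 * e s) ->
  q 0 = 0 -> forall s, 0 <= s <= t -> e s = e 0 * cos (w * s).
Proof.
move=> de dq e'q q'e q0.
have dlin (z : R) : is_derive z 1 (fun s : R => w * s) w.
  by apply: is_derive1_eq (is_derive1_scale w (is_derive1_idfun z)) _; rewrite mulr1.
have dcos (z : R) : is_derive z 1 (fun s => cos (w * s)) (- sin (w * z) * w).
  exact: (is_derive1_chain (u := cos) (dlin z) (is_derive_cos _)).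
have dsin (z : R) : is_derive z 1 (fun s => sin (w * s)) (cos (w * z) * w).
  exact: (is_derive1_chain (u := sin) (dlin z) (is_derive_sin _)).
pose d s := e s - e 0 * cos (w * s); pose r s := q s + e 0 * w * sin (w * s).
have dd (z : R) : is_derive z 1 d (e' z - e 0 * (- sin (w * z) * w)).
  exact: (is_derive1_sub (de z) (is_derive1_scale _ (dcos z))).
have dr (z : R) : is_derive z 1 r (q' z + e 0 * w * (cos (w * z) * w)).
  exact: (is_derive1_add (dq z) (is_derive1_scale _ (dsin z))).
have d0 : d 0 = 0 by rewrite /d mulr0 cos0 mulr1 subrr.
have r0 : r 0 = 0 by rewrite /r mulr0 sin0 mulr0 addr0.
pose N s := w ^+ 2 * (d s * d s) + r s * r s.
have dN (z : R) := is_derive1_add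
  (is_derive1_scale (w ^+ 2) (is_derive1_mul (dd z) (dd z))) (is_derive1_mul (dr z) (dr z)).
have N0 s : 0 <= s <= t -> N s = 0.
  move=> st; rewrite (derive0_cst_itv (u := N) dN _ st).
    by rewrite /N d0 r0 !mulr0 addr0.
  by move=> z zt; rewrite e'q// q'e// /d /r; ring.
have rs0 s : 0 <= s <= t -> r s = 0.
  move=> /N0 /eqP; rewrite /N paddr_eq0; last 2 first.
  - by rewrite mulr_ge0 ?sqr_ge0// -expr2 sqr_ge0.
  - by rewrite -expr2 sqr_ge0.
  by move=> /andP[_]; rewrite mulf_eq0 orbb => /eqP.
have ds0 s : 0 <= s <= t -> d s = 0.
  move=> st; rewrite (derive0_cst_itv dd _ st)// => z zt.
  by rewrite e'q//; have := rs0 z zt; rewrite /r; lra.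
by move=> s /ds0 /eqP; rewrite subr_eq0 => /eqP.
Qed.

(** * Extension in time *)

Section Extension.
Context {R : realType}.

Definition clamp (T s : R) := Num.max 0 (Num.min s T).

Lemma clampP (T s : R) : 0 <= T -> 0 <= clamp T s <= T.
Proof. by move=> T0; rewrite /clamp le_max lexx ge_max T0 ge_min lexx orbT. Qed.

Lemma clamp_id (T s : R) : 0 <= s <= T -> clamp T s = s.
Proof. by move=> /andP[s0 sT]; rewrite /clamp (min_idPl sT); exact/max_idPr. Qed.

Lemma clamp_lo (T s : R) : 0 <= T -> s <= 0 -> clamp T s = 0.
Proof. by move=> T0 s0; rewrite /clamp; apply/max_idPl; rewrite ge_min s0. Qed.

Lemma clamp_hi (T s : R) : 0 <= T -> T <= s -> clamp T s = T.
Proof. by move=> T0 s0; rewrite /clamp (min_idPr s0); exact/max_idPr. Qed.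

Lemma continuous_clamp (T : R) : continuous (clamp T).
Proof.
move=> s; apply: (@continuous_max R R (fun=> 0) (fun s => Num.min s T)).
  exact: cvg_cst.
by apply: (@continuous_min R R id (fun=> T)); [exact: cvg_id|exact: cvg_cst].
Qed.

(** Continues u beyond [0, T] along its end tangents, so that a one-sided
    derivative at an end point becomes a two-sided one. *)
Definition affine_ext (T : R) (u u' : R -> R) (s : R) : R :=
  u (clamp T s) + (s - clamp T s) * u' (clamp T s).

Lemma affine_ext_id (T : R) (u u' : R -> R) (s : R) : 0 <= s <= T ->
  affine_ext T u u' s = u s.
Proof. by move=> sT; rewrite /affine_ext clamp_id// subrr mul0r addr0. Qed.

Lemma is_derive_affine_ext (T : R) (u u' : R -> R) (s : R) : 0 < T ->
  (forall s, 0 <= s <= T -> is_derive_within `[0, T] u s (u' s)) ->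
  is_derive s 1 (affine_ext T u u') (u' (clamp T s)).
Proof.
move=> T0 du; have T0' := ltW T0.
pose l := u' (clamp T s); pose U := affine_ext T u u'.
apply/is_derive1_caratheodory.
pose g z := if z == s then l else (U z - U s) / (z - s).
have gs : g s = l by rewrite /g eqxx.
exists g; split; last exact: gs; last first.
- apply/cvgrPdist_lt => e e0; rewrite gs /g.
  have [s0|s0] := ltP s 0.
    near=> z; case: eqVneq => [_|zs]; first by rewrite subrr normr0.
    have z0 : z < 0 by near: z; exact: lt_nbhsl.
    rewrite /U /affine_ext /l !clamp_lo ?ltW// !subr0.
    rewrite opprD addrACA subrr add0r -mulrBl mulrAC mulfV ?subr_eq0//.
    by rewrite mul1r subrr normr0.
  have [sT|sT] := ltP T s.
    near=> z; case: eqVneq => [_|zs]; first by rewrite subrr normr0.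
    have z0 : T < z by near: z; exact: lt_nbhsr.
    rewrite /U /affine_ext /l !clamp_hi ?ltW//.
    rewrite opprD addrACA subrr add0r -mulrBl.
    rewrite (_ : z - T - (s - T) = z - s); last by lra.
    by rewrite mulrAC mulfV ?subr_eq0// mul1r subrr normr0.
  have sI : 0 <= s <= T by rewrite s0.
  have := du _ sI => /cvgrPdist_lt/(_ _ e0).
  rewrite near_withinE /dnbhs near_withinE => H.
  have n0 : \forall z \near s, z < 0 -> s = 0.
    have [->|sn0] := eqVneq s 0; first by near=> z.
    have sp : 0 < s by rewrite lt_neqAle eq_sym sn0.
    by apply: filterS (lt_nbhsr sp) => z z0 z0'; move: (lt_trans z0 z0'); rewrite ltxx.
  have nT : \forall z \near s, T < z -> s = T.
    have [->|snT] := eqVneq s T; first by near=> z.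
    have sp : s < T by rewrite lt_neqAle snT.
    by apply: filterS (lt_nbhsl sp) => z z0 z0'; move: (lt_trans z0 z0'); rewrite ltxx.
  near=> z; case: eqVneq => [_|zs]; first by rewrite subrr normr0.
  rewrite /U /l /affine_ext (clamp_id sI) subrr mul0r addr0.
  have [z0|z0] := ltP z 0.
    have s0' : s = 0 by move: z0; near: z.
    rewrite s0' clamp_lo// ?ltW// !subr0 addrAC subrr add0r.
    by rewrite mulrAC mulfV ?mul1r ?subrr ?normr0// ?lt_eqF.
  have [zT|zT] := ltP T z.
    have s0' : s = T by move: zT; near: z.
    have zT0 : z - T != 0 by rewrite subr_eq0 gt_eqF.
    rewrite s0' clamp_hi// ?ltW// addrAC subrr add0r.
    by rewrite mulrAC mulfV ?mul1r ?subrr ?normr0.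
  have zin : 0 <= z <= T by rewrite z0.
  rewrite clamp_id// subrr mul0r addr0.
  by move: zs zin; near: z; apply: filterS H => z Hz zs zin; apply: Hz => //=; rewrite in_itv.
- move=> z; rewrite /g; have [->|zs] := eqVneq z s; first by rewrite !subrr mulr0.
  by rewrite mulfVK// subr_eq0.
Unshelve. all: by end_near. Qed.

Lemma continuous_clamp_slab (T : R) (f : R -> R -> R -> R) : 0 <= T ->
  {within slab T, continuous (fun p : R * R * R => f p.1.1 p.1.2 p.2)} ->
  continuous (fun p : R * R * R => f (clamp T p.1.1) p.1.2 p.2).
Proof.
move=> T0 cf p.
pose c (p : R * R * R) := (clamp T p.1.1, p.1.2, p.2).
have cc : {for p, continuous c}.
  have c11 : (fun p : R * R * R => clamp T p.1.1) z @[z --> p] --> clamp T p.1.1.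
    apply: (@continuous_comp _ _ _ (fun z : R * R * R => z.1.1) (clamp T)).
      by apply: (@continuous_comp _ _ _ (fun z : R * R * R => z.1) (fun z : R * R => z.1));
        exact: cvg_fst.
    exact: continuous_clamp.
  have c12 : (fun z : R * R * R => z.1.2) z @[z --> p] --> p.1.2.
    by apply: (@continuous_comp _ _ _ (fun z : R * R * R => z.1) (fun z : R * R => z.2));
      [exact: cvg_fst|exact: cvg_snd].
  exact: (cvg_pair (cvg_pair c11 c12) cvg_snd).
have sl z : slab T (c z) by exact: clampP.
move/subspace_continuousP : cf => /(_ (c p) (sl p)) H.
have H' := cvg_trans _ H; apply: H' => B /= HB.
have {}HB : nbhs p [set z | slab T (c z) -> B (f (c z).1.1 (c z).1.2 (c z).2)] := cc _ HB.
by apply: filterS HB => z Hz; exact: (Hz (sl z)).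
Qed.

End Extension.

(** The time variable can be taken in the whole line: two-sided derivatives and
    globally continuous functions then replace one-sided derivatives and
    continuity relative to the slab.  Only the time derivative survives outside
    [0, T]; the equation is used inside. *)
Lemma C1_slab_extension {R : realType} (T : R) (f ft fx fv : R -> R -> R -> R) :
  0 < T -> C1_slab T f ft fx fv ->
  exists fe fte fxe fve : R -> R -> R -> R, [/\
    [/\ continuous (fun z : R * R * R => fe z.1.1 z.1.2 z.2),
        continuous (fun z : R * R * R => fte z.1.1 z.1.2 z.2),
        continuous (fun z : R * R * R => fxe z.1.1 z.1.2 z.2) &
        continuous (fun z : R * R * R => fve z.1.1 z.1.2 z.2)],
    forall s x v : R, is_derive s 1 (fun s => fe s x v) (fte s x v) &
    forall s, 0 <= s <= T -> [/\ fe s = f s, fte s = ft s, fxe s = fx s & fve s = fv s]].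
Proof.
move=> T0 C; have T0' := ltW T0.
exists (fun s x v => affine_ext T (fun s => f s x v) (fun s => ft s x v) s).
exists (fun s => ft (clamp T s)), (fun s => fx (clamp T s)), (fun s => fv (clamp T s)).
have cft := continuous_clamp_slab T0' (C1_slab_cont_t C).
split.
- split.
  + apply: continuous_add; first exact: continuous_clamp_slab T0' (C1_slab_cont C).
    apply: continuous_mul; last exact: cft.
    apply: continuous_sub; first exact: continuous_coord1.
    move=> z; apply: (@continuous_comp _ _ _ (fun z : R * R * R => z.1.1) (clamp T)).
      exact: continuous_coord1.
    exact: continuous_clamp.
  + exact: cft.
  + exact: continuous_clamp_slab T0' (C1_slab_cont_x C).
  + exact: continuous_clamp_slab T0' (C1_slab_cont_v C).
- move=> s x v.
  by apply: is_derive_affine_ext => // z; exact: (C1_slab_t C).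
- move=> s sT; split; rewrite ?clamp_id//.
  by apply/funext => x; apply/funext => v; rewrite affine_ext_id.
Qed.

(** * A maximum principle for transport equations *)

Section MaxPrinciple.
Context {R : realType}.
Variables (t0 Q a b : R) (w ws wx wv A : R -> R -> R -> R).
Let inside (s x v : R) := [/\ 0 < s <= t0, a + Q * s < x < b - Q * s & `|v| < Q].

Hypothesis Q0 : 0 <= Q.
Hypothesis cw : continuous (fun z : R * R * R => w z.1.1 z.1.2 z.2).
Hypothesis ds : forall s x v : R, inside s x v ->
  is_derive s 1 (fun s => w s x v) (ws s x v).
Hypothesis dx : forall s x v : R, inside s x v ->
  is_derive x 1 (fun x => w s x v) (wx s x v).
Hypothesis dv : forall s x v : R, inside s x v ->
  is_derive v 1 (fun v => w s x v) (wv s x v).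
Hypothesis pde : forall s x v, inside s x v ->
  ws s x v + v * wx s x v - A s x v * wv s x v <= 0.
Hypothesis init : forall x v, a <= x <= b -> w 0 x v <= 0.
Hypothesis bdry : forall s x v, 0 <= s <= t0 -> a + Q * s <= x <= b - Q * s ->
  Q <= `|v| -> w s x v <= 0.

(** Let chi = (x - a - Q s) (b - Q s - x), which vanishes on the lateral sides
    and satisfies chi_s + v chi_x <= 0 for |v| <= Q.  If w > 0 somewhere, then
    for small e > 0 the function chi w - e s has a positive maximum over the
    closed trapezoid and |v| <= Q, attained where chi > 0, s > 0 and |v| < Q.
    There its derivatives in x and v vanish and its derivative in s is
    nonnegative, which contradicts the differential inequality.  Since wv
    vanishes at that point, the coefficient A may be arbitrary. *)
Lemma transport_max_principle (s x v : R) :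
  0 <= s <= t0 -> a + Q * s < x < b - Q * s -> w s x v <= 0.
Proof.
move=> /andP[s0 st] /andP[ax xb].
have axb : a + Q * s <= x <= b - Q * s by rewrite !ltW.
rewrite leNgt; apply/negP => w0.
have sgt0 : 0 < s.
  rewrite lt_neqAle s0 andbT eq_sym; apply/negP => /eqP s00; move: w0.
  by subst s; rewrite ltNge init//; lra.
have vQ : `|v| < Q.
  by rewrite ltNge; apply/negP => /(@bdry s x v) H; move: w0; rewrite ltNge H// s0.
pose chi s x := (x - a - Q * s) * (b - Q * s - x).
have chi0 : 0 < chi s x by rewrite /chi mulr_gt0//; lra.
(* chosen so that chi w - e s is still positive at (s, x, v) *)
pose e := chi s x * w s x v / (2 * s).
have e0 : 0 < e by rewrite /e divr_gt0 // mulr_gt0.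
pose W (z : R * R * R) := chi z.1.1 z.1.2 * w z.1.1 z.1.2 z.2 - e * z.1.1.
have cW : continuous W.
  have [c1 c2] := (@continuous_coord1 R, @continuous_coord2 R).
  have cst := @continuous_cst R (R * R * R)%type.
  apply: continuous_sub; last by apply: continuous_mul.
  apply: continuous_mul => //.
  by do ![apply: continuous_mul|apply: continuous_sub].
pose K : set (R * R * R) := [set` `[0, t0]] `*` [set` `[a, b]] `*` [set` `[- Q, Q]]
  `&` [set z | a + Q * z.1.1 <= z.1.2 <= b - Q * z.1.1].
have KE s' x' v' : K (s', x', v') <->
    [/\ 0 <= s' <= t0, a <= x' <= b, - Q <= v' <= Q & a + Q * s' <= x' <= b - Q * s'].
  by rewrite /K /= !in_itv/=; split => [[[[? ?] ?] ?]|[? ? ? ?]].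
have cK : compact K.
  apply: compact_closedI.
    by apply: compact_setX; [apply: compact_setX|]; exact: segment_compact.
  have -> : [set z : R * R * R | a + Q * z.1.1 <= z.1.2 <= b - Q * z.1.1] =
      (fun z : R * R * R => z.1.2 - Q * z.1.1) @^-1` [set y | a <= y] `&`
      (fun z : R * R * R => z.1.2 + Q * z.1.1) @^-1` [set y | y <= b].
    apply/seteqP; split => -[[s' x'] v']/=.
      by move=> /andP[? ?]; split; lra.
    by move=> [? ?]; apply/andP; split; lra.
  have [c1 c2] := (@continuous_coord1 R, @continuous_coord2 R).
  have cst := @continuous_cst R (R * R * R)%type.
  apply: closedI; apply: preimage_closed; try by [exact: closed_ge|exact: closed_le].
    by move=> z _; apply: continuous_sub => //; apply: continuous_mul.
  by move=> z _; apply: continuous_add => //; apply: continuous_mul.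
have Qs0 : 0 <= Q * s by rewrite mulr_ge0.
have Ksxv : K (s, x, v).
  apply/KE; split => //; first by rewrite s0.
    by apply/andP; split; lra.
  by rewrite -ler_norml ltW.
have [[[S X] V] /= KZ Wmax] := compact_EVT_max (ex_intro _ _ Ksxv) cK (continuous_subspaceT cW).
move: KZ; rewrite inE => /KE[/andP[S0 St] aXb QV /andP[aX Xb]].
have {}Wmax s' x' v' : 0 <= s' <= t0 -> a <= x' <= b -> - Q <= v' <= Q ->
    a + Q * s' <= x' <= b - Q * s' -> W (s', x', v') <= W (S, X, V).
  by move=> ? ? ? ?; apply: Wmax; rewrite inE; apply/KE.
have Wpos : 0 < W (S, X, V).
  apply: (@lt_le_trans _ _ (W (s, x, v))).
    rewrite /W/= /e (_ : _ - _ = chi s x * w s x v / 2); last by field; lra.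
    by rewrite divr_gt0// mulr_gt0.
  by apply: Wmax; rewrite ?s0// -?ler_norml ?(ltW vQ)//; lra.
have chi_ge0 : 0 <= chi S X by rewrite /chi mulr_ge0; lra.
have eS : 0 <= e * S by rewrite mulr_ge0// ltW.
have chiw : 0 < chi S X * w S X V by move: Wpos; rewrite /W/=; lra.
have chi_gt0 : 0 < chi S X.
  by rewrite lt_neqAle chi_ge0 andbT eq_sym; apply: contraTneq chiw => ->; rewrite mul0r ltxx.
have w_gt0 : 0 < w S X V by rewrite pmulr_rgt0 in chiw.
have aX' : a + Q * S < X.
  rewrite lt_neqAle aX andbT; apply/eqP => aXE; move: chi_gt0.
  by rewrite /chi (_ : X - a - Q * S = 0) ?mul0r ?ltxx//; lra.
have Xb' : X < b - Q * S.
  rewrite lt_neqAle Xb andbT; apply/eqP => aXE; move: chi_gt0.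
  by rewrite /chi (_ : b - Q * S - X = 0) ?mulr0 ?ltxx//; lra.
have Sgt0 : 0 < S.
  rewrite lt_neqAle S0 andbT eq_sym; apply/eqP => S00; subst S.
  by move: w_gt0; rewrite ltNge init//; lra.
have VQ : `|V| < Q.
  rewrite ltNge; apply/negP => /(@bdry S X V) H; move: w_gt0; rewrite ltNge H//; lra.
have ins : inside S X V by split => //; lra.
have /andP[VQ1 VQ2] : - Q < V < Q by rewrite -ltr_norml.
have QS : 0 <= Q * S by rewrite mulr_ge0.
clear KE cK Ksxv Qs0 w0 sgt0 vQ chi0 axb ax xb s0 st aX Xb eS.
have dWv : is_derive V 1 (fun v => W (S, X, v)) (chi S X * wv S X V).
  apply: (is_derive1_eq (l := chi S X * wv S X V - 0)); last by rewrite subr0.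
  rewrite /W/=.
  exact: (is_derive1_sub (is_derive1_scale _ (dv ins)) (is_derive1_const _ _)).
have wv0 : chi S X * wv S X V = 0.
  apply/eqP; rewrite eq_le; apply/andP; split.
    by apply: derive_le0_right_max dWv VQ2 _ => z zV; apply: Wmax; lra.
  by apply: derive_ge0_left_max dWv VQ1 _ => z zV; apply: Wmax; lra.
have dWx : is_derive X 1 (fun x => W (S, x, V))
   ((b - Q * S - X - (X - a - Q * S)) * w S X V + chi S X * wx S X V).
  apply: (is_derive1_eq (l := ((1 - 0 - 0) * (b - Q * S - X) + (X - a - Q * S) * (0 - 1))
     * w S X V + chi S X * wx S X V - 0)); last by ring.
  rewrite /W/= /chi.
  have dk := is_derive1_const _ X; have di := is_derive1_idfun X.
  have d1 := is_derive1_sub (is_derive1_sub di (dk a)) (dk (Q * S)).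
  have d2 := is_derive1_sub (dk (b - Q * S)) di.
  exact: (is_derive1_sub
    (is_derive1_mul (is_derive1_mul d1 d2) (dx ins)) (dk (e * S))).
have wx0 : (b - Q * S - X - (X - a - Q * S)) * w S X V + chi S X * wx S X V = 0.
  apply/eqP; rewrite eq_le; apply/andP; split.
    by apply: derive_le0_right_max dWx Xb' _ => z zV; apply: Wmax; lra.
  by apply: derive_ge0_left_max dWx aX' _ => z zV; apply: Wmax; lra.
have dWs : is_derive S 1 (fun s => W (s, X, V))
   (- Q * (b - Q * S - X + (X - a - Q * S)) * w S X V + chi S X * ws S X V - e).
  apply: (is_derive1_eq (l := ((0 - Q * 1) * (b - Q * S - X) + (X - a - Q * S) * ((0 - Q * 1) - 0))
     * w S X V + chi S X * ws S X V - e * 1)); last by ring.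
  rewrite /W/= /chi.
  have dk := is_derive1_const _ S; have dQ := is_derive1_scale Q (is_derive1_idfun S).
  have d1 := is_derive1_sub (dk (X - a)) dQ.
  have d2 := is_derive1_sub (is_derive1_sub (dk b) dQ) (dk X).
  exact: (is_derive1_sub
    (is_derive1_mul (is_derive1_mul d1 d2) (ds ins))
    (is_derive1_scale e (is_derive1_idfun S))).
have ws0 : 0 <= - Q * (b - Q * S - X + (X - a - Q * S)) * w S X V + chi S X * ws S X V - e.
  apply: derive_ge0_left_max dWs Sgt0 _ => z /andP[z0 zS].
  have Qz : Q * z <= Q * S by rewrite ler_wpM2l.
  by apply: Wmax; lra.
have p : chi S X * (ws S X V + V * wx S X V - A S X V * wv S X V) <= 0.
  by apply: mulr_ge0_le0; [|exact: pde].
have q1 : 0 <= (Q - V) * (b - Q * S - X) * w S X V by rewrite !mulr_ge0//; lra.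
have q2 : 0 <= (Q + V) * (X - a - Q * S) * w S X V by rewrite !mulr_ge0//; lra.
have eqn : chi S X * (ws S X V + V * wx S X V - A S X V * wv S X V) =
  (- Q * (b - Q * S - X + (X - a - Q * S)) * w S X V + chi S X * ws S X V - e)
  + V * ((b - Q * S - X - (X - a - Q * S)) * w S X V + chi S X * wx S X V)
  - A S X V * (chi S X * wv S X V)
  + (Q - V) * (b - Q * S - X) * w S X V + (Q + V) * (X - a - Q * S) * w S X V + e by ring.
by move: p; rewrite eqn wv0 wx0 !mulr0; lra.
Qed.
End MaxPrinciple.

(** * Charge conservation *)

Section Moments.
Context {R : realType}.
Local Notation mu := (@lebesgue_measure R).
Variables (Q : R) (F : R -> R) (f ft : R -> R -> R -> R).

Definition density (s x : R) := \int[mu]_(v in `[- Q, Q]) (F v - f s x v).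
Definition momentum (s x : R) := \int[mu]_(v in `[- Q, Q]) (v * f s x v).
Definition total_charge (x1 x2 s : R) := \int[mu]_(y in `[x1, x2]) density s y.
Definition charge_rate (x1 x2 s : R) :=
  \int[mu]_(y in `[x1, x2]) \int[mu]_(v in `[- Q, Q]) - ft s y v.

End Moments.

(** What remains of a solution on [0, t0] when F and f vanish for |v| >= Q and
    the time variable has been extended to the whole line.  The Poisson equation
    enters through increments of E only; the behaviour at infinity is used later
    to find E itself. *)
Record confined_solution {R : realType} (t0 Q : R) (F : R -> R)
    (f ft fx fv : R -> R -> R -> R) (E : R -> R -> R) : Prop := {
  horizon_gt0 : 0 < t0 ;
  speed_gt0 : 0 < Q ;
  confined_continuous_bg : continuous F ;
  confined_continuous : continuous (fun z : R * R * R => f z.1.1 z.1.2 z.2) ;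
  confined_continuous_t : continuous (fun z : R * R * R => ft z.1.1 z.1.2 z.2) ;
  confined_continuous_x : continuous (fun z : R * R * R => fx z.1.1 z.1.2 z.2) ;
  confined_continuous_v : continuous (fun z : R * R * R => fv z.1.1 z.1.2 z.2) ;
  confined_dt : forall s x v : R, is_derive s 1 (fun s => f s x v) (ft s x v) ;
  confined_dx : forall s x v : R, 0 <= s <= t0 ->
    is_derive x 1 (fun x => f s x v) (fx s x v) ;
  confined_dv : forall s x v : R, 0 <= s <= t0 ->
    is_derive v 1 (fun v => f s x v) (fv s x v) ;
  confined_vlasov : forall s x v, 0 <= s <= t0 ->
    ft s x v + v * fx s x v - E s x * fv s x v = 0 ;
  confined_supp : forall s x v, 0 <= s <= t0 -> Q <= `|v| -> f s x v = 0 ;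
  confined_poisson : forall s x1 x2, 0 <= s <= t0 -> x1 <= x2 ->
    E s x2 - E s x1 = total_charge Q F f x1 x2 s }.

Section Core.
Context {R : realType}.
Local Notation mu := (@lebesgue_measure R).
Variables (t0 Q : R) (F : R -> R) (f ft fx fv : R -> R -> R -> R) (E : R -> R -> R).
Hypothesis sol : confined_solution t0 Q F f ft fx fv E.

Local Notation density := (density Q F f).
Local Notation momentum := (momentum Q f).
Local Notation total_charge := (total_charge Q F f).
Local Notation charge_rate := (charge_rate Q ft).

Let t0_gt0 := horizon_gt0 sol.
Let Q_gt0 := speed_gt0 sol.
Let cF := confined_continuous_bg sol.
Let cf := confined_continuous sol.
Let cft := confined_continuous_t sol.
Let cfx := confined_continuous_x sol.
Let cfv := confined_continuous_v sol.
Let dt := confined_dt sol.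
Let dx := confined_dx sol.
Let dv := confined_dv sol.
Let vlasov := confined_vlasov sol.
Let f_supp := confined_supp sol.
Let poisson := confined_poisson sol.

Let QQ : - Q <= Q. Proof. by move: Q_gt0; lra. Qed.
Let c1 := @continuous_coord1 R.
Let c2 := @continuous_coord2 R.
Let c3 := @continuous_coord3 R.

Let cfst : continuous (fun z : R * R => z.1). Proof. by move=> z; exact: cvg_fst. Qed.
Let csnd : continuous (fun z : R * R => z.2). Proof. by move=> z; exact: cvg_snd. Qed.
Let cid : continuous (fun z : R => z). Proof. by move=> z; exact: cvg_id. Qed.

Lemma continuous_integrand : continuous (fun z : R * R * R => F z.2 - f z.1.1 z.1.2 z.2).
Proof.
apply: continuous_sub => // z.
by apply: (@continuous_comp _ _ _ (fun z : R * R * R => z.2) F); [exact: cvg_snd|exact: cF].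
Qed.

Lemma continuous_density : continuous (fun z : R * R => density z.1 z.2).
Proof.
exact: (@continuous_Rintegral_param R (R * R)%type (fun z v => F v - f z.1 z.2 v)
  (- Q) Q QQ continuous_integrand).
Qed.

Lemma is_derive_density (s x : R) :
  is_derive s 1 (fun s => density s x) (\int[mu]_(v in `[- Q, Q]) - ft s x v).
Proof.
apply: (@is_derive_Rintegral_param R (fun s v => F v - f s x v) (fun s v => - ft s x v)) => //.
- move=> z v; rewrite -[- ft _ _ _]add0r.
  exact: (is_derive1_sub (is_derive1_const _ _) (dt z x v)).
- move=> z; apply: continuous_sub => //.
  by apply: (continuous_comp3 cf) => //; exact: continuous_cst.
- have h : continuous (fun z : R * R => ft z.1 x z.2).
    by apply: (continuous_comp3 cft) => //; exact: continuous_cst.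
  by move=> z; apply: cvgN; exact: h.
Qed.

Lemma is_derive_charge (x1 x2 s : R) : x1 <= x2 ->
  is_derive s 1 (total_charge x1 x2) (charge_rate x1 x2 s).
Proof.
move=> x12.
apply: (@is_derive_Rintegral_param R density
   (fun s y => \int[mu]_(v in `[- Q, Q]) - ft s y v)) => //.
- by move=> z y; exact: is_derive_density.
- by move=> z; apply: (continuous_comp2 continuous_density) => //; exact: continuous_cst.
- apply: (@continuous_Rintegral_param R (R * R)%type (fun z v => - ft z.1 z.2 v)
    (- Q) Q QQ) => z.
  by apply: cvgN; exact: cft.
Qed.

Lemma is_derive_momentum_x (s x : R) : 0 <= s <= t0 ->
  is_derive x 1 (momentum s) (\int[mu]_(v in `[- Q, Q]) (v * fx s x v)).
Proof.
move=> st.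
apply: (@is_derive_Rintegral_param R (fun x v => v * f s x v)
  (fun x v => v * fx s x v)) => //.
- by move=> z v; exact: (is_derive1_scale v (dx z v st)).
- move=> z; apply: continuous_mul => //.
  by apply: (continuous_comp3 cf) => //; exact: continuous_cst.
- apply: continuous_mul => //.
  by apply: (continuous_comp3 cfx) => //; exact: continuous_cst.
Qed.

Lemma is_derive_momentum_t (s x : R) :
  is_derive s 1 (fun s => momentum s x) (\int[mu]_(v in `[- Q, Q]) (v * ft s x v)).
Proof.
apply: (@is_derive_Rintegral_param R (fun s v => v * f s x v)
  (fun s v => v * ft s x v)) => //.
- by move=> z v; exact: (is_derive1_scale v (dt z x v)).
- move=> z; apply: continuous_mul => //.
  by apply: (continuous_comp3 cf) => //; exact: continuous_cst.
- apply: continuous_mul => //.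
  by apply: (continuous_comp3 cft) => //; exact: continuous_cst.
Qed.

Let cvar3 (g : R -> R -> R -> R) (s x : R) :
  continuous (fun z : R * R * R => g z.1.1 z.1.2 z.2) -> continuous (g s x).
Proof. by move=> cg; apply: (continuous_comp3 cg) => //; exact: continuous_cst. Qed.

Lemma integral_fv (s x : R) : 0 <= s <= t0 -> \int[mu]_(v in `[- Q, Q]) fv s x v = 0.
Proof.
move=> st; have -> := Rintegral_derive (@cvar3 fv s x cfv) QQ (fun v => dv x v st).
by rewrite !f_supp ?subrr// ?normrN ger0_norm// ltW.
Qed.

(** The field disappears from the charge balance: E does not depend on v and
    fv has integral 0.  No regularity of E is therefore involved in
    differentiating the charge. *)
Lemma integral_ft (s x : R) : 0 <= s <= t0 ->
  \int[mu]_(v in `[- Q, Q]) - ft s x v = \int[mu]_(v in `[- Q, Q]) (v * fx s x v).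
Proof.
move=> st.
have cE : continuous (fun v : R => E s x * fv s x v).
  by apply: continuous_mul; [exact: continuous_cst|exact: cvar3].
have cvx : continuous (fun v : R => v * fx s x v).
  by apply: continuous_mul => //; exact: cvar3.
transitivity (\int[mu]_(v in `[- Q, Q]) (v * fx s x v - E s x * fv s x v)).
  by apply: eq_Rintegral => v _; have := vlasov x v st; lra.
rewrite RintegralB//; last 2 first.
- exact: continuous_integrable_itv.
- exact: continuous_integrable_itv.
rewrite RintegralZl//; last exact: continuous_integrable_itv (@cvar3 fv s x cfv).
by rewrite integral_fv// mulr0 subr0.
Qed.

(** Conservation of charge on [x1, x2].  Both the integral over v and the one
    over x are differentiated under the integral sign, and the inner one is
    recognized as the x-derivative of the momentum, so the order of integration
    is never exchanged. *)
Lemma charge_rateE (x1 x2 s : R) : x1 <= x2 -> 0 <= s <= t0 ->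
  charge_rate x1 x2 s = momentum s x2 - momentum s x1.
Proof.
move=> x12 st.
have cg : continuous (fun x : R => \int[mu]_(v in `[- Q, Q]) (v * fx s x v)).
  apply: (@continuous_Rintegral_param R R (fun x v => v * fx s x v)) => //.
  apply: continuous_mul => //.
  by apply: (continuous_comp3 cfx) => //; exact: continuous_cst.
rewrite -(Rintegral_derive cg x12 (fun x => is_derive_momentum_x x st)).
by apply: eq_Rintegral => y _; exact: integral_ft.
Qed.

(** * Trapezoids over an unperturbed base *)

Section Trapezoid.
Variables (a b : R).
Hypothesis init : forall x v, a <= x <= b -> f 0 x v = F v.

(** The weight expR (l * s) makes each integration in time gain a factor
    1 / l. *)
Definition lipschitz_x (k l : R) := forall s x y v, 0 <= s <= t0 ->
  a + Q * s < x -> x <= y -> y < b - Q * s ->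
  `|f s y v - f s x v| <= k * expR (l * s) * (y - x).

Lemma trapezoid_sub (s' s x : R) : 0 <= s' <= s -> a + Q * s < x < b - Q * s ->
  a + Q * s' < x < b - Q * s'.
Proof.
move=> /andP[s'0 s's] xab; have : Q * s' <= Q * s by rewrite ler_wpM2l// ltW.
by lra.
Qed.

(** The charge of [x, y] starts from 0 and its rate is a difference of momenta,
    controlled by the Lipschitz bound on f. *)
Lemma lipschitz_field (k l s x y : R) : 0 <= k -> 0 < l -> lipschitz_x k l ->
  0 <= s <= t0 -> a + Q * s < x -> x <= y -> y < b - Q * s ->
  `|E s y - E s x| <= 2 * Q ^+ 2 * k / l * expR (l * s) * (y - x).
Proof.
move=> k0 l0 lip st ax xy yb; have /andP[s0 st'] := st.
rewrite (poisson st xy).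
pose c := 2 * Q ^+ 2 * k * (y - x).
have c0 : 0 <= c by rewrite !mulr_ge0 ?subr_ge0// ltW.
have Qs0 : 0 <= Q * s by rewrite mulr_ge0// ltW.
have ch0 : total_charge x y 0 = 0.
  transitivity (\int[mu]_(z in `[x, y]) (0 : R)).
    apply: eq_Rintegral => z; rewrite inE/= in_itv/= => /andP[z1 z2].
    transitivity (\int[mu]_(v in `[- Q, Q]) (0 : R)); last first.
      by rewrite Rintegral_cst// mul0r.
    by apply: eq_Rintegral => v _; rewrite init ?subrr//; lra.
  by rewrite Rintegral_cst// mul0r.
have bound r : 0 <= r <= s -> `|charge_rate x y r| <= c * expR (l * r).
  move=> rs; have rt : 0 <= r <= t0 by lra.
  have /(trapezoid_sub rs) xr : a + Q * s < x < b - Q * s by lra.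
  have /(trapezoid_sub rs) yr : a + Q * s < y < b - Q * s by lra.
  rewrite charge_rateE// /momentum -RintegralB//; last 2 first.
  - by apply: continuous_integrable_itv; apply: continuous_mul => //; exact: cvar3.
  - by apply: continuous_integrable_itv; apply: continuous_mul => //; exact: cvar3.
  have -> : c * expR (l * r) = Q * (k * expR (l * r) * (y - x)) * (Q - - Q).
    by rewrite /c; ring.
  apply: norm_Rintegral_itv_le => //.
    by apply: continuous_sub; apply: continuous_mul => //; exact: cvar3.
  move=> v vQ; rewrite -mulrBr normrM ler_pM//; first by rewrite ler_norml.
  by apply: lip => //; lra.
have dw (z : R) : is_derive z 1 (fun r => c / l * expR (l * r)) (c * expR (l * z)).
  apply: is_derive1_eq (is_derive1_scale (c / l) (is_derive_expR_linear l z)) _.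
  by field; lra.
have dch z := is_derive_charge z xy.
have cl0 : 0 <= c / l by rewrite divr_ge0// ltW.
have -> : 2 * Q ^+ 2 * k / l * expR (l * s) * (y - x) = c / l * expR (l * s).
  by rewrite /c; field; lra.
have bound1 r : 0 <= r <= s -> charge_rate x y r <= c * expR (l * r).
  by move=> /bound; rewrite ler_norml => /andP[].
have bound2 r : 0 <= r <= s -> - charge_rate x y r <= c * expR (l * r).
  by move=> /bound; rewrite ler_norml => /andP[]; lra.
have := derive_le_increment s0 dch dw bound1.
have := derive_le_increment s0 (fun z => is_derive1_opp (dch z)) dw bound2.
rewrite ch0 mulr0 expR0 => h2 h1.
by rewrite ler_norml; lra.
Qed.

(** With d = y - x, the translate f(s, x + d, v) - f(s, x, v) solves the
    transport equation with source (E(s, x + d) - E(s, x)) fv(s, x + d, v), which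
    [lipschitz_field] bounds by (2 Q^2 k L / l) d e^(l s).  The barrier
    (k / 2) d e^(l s) dominates it as soon as 4 Q^2 L <= l^2. *)
Lemma lipschitz_halving (k l L : R) : 0 <= k -> 1 <= l -> 4 * Q ^+ 2 * L <= l ->
  (forall s x v, 0 <= s <= t0 -> a <= x <= b -> `|v| <= Q -> `|fv s x v| <= L) ->
  lipschitz_x k l -> lipschitz_x (k / 2) l.
Proof.
move=> k0 l1 lL fvL lip s x y v st ax xy yb.
have [->|xny] := eqVneq x y; first by rewrite !subrr normr0 mulr0.
pose d := y - x; have d0 : 0 < d by rewrite subr_gt0 lt_neqAle xny.
have l0 : 0 < l by lra.
suff H sg : sg = 1 \/ sg = -1 -> sg * (f s y v - f s x v) <= k / 2 * expR (l * s) * d.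
  have := H 1 (or_introl erefl); have := H (-1) (or_intror erefl).
  by rewrite ler_norml -/d; lra.
move=> hsg.
pose w s x v := sg * (f s (x + d) v - f s x v) - k / 2 * d * expR (l * s).
have xd : x + d = y by rewrite /d; lra.
suff : w s x v <= 0 by rewrite /w xd; lra.
have h (g : R -> R -> R -> R) : continuous (fun z : R * R * R => g z.1.1 z.1.2 z.2) ->
    continuous (fun z : R * R * R => g z.1.1 (z.1.2 + d) z.2).
  move=> cg; apply: (continuous_comp3 cg) => //.
  by apply: continuous_add => //; exact: continuous_cst.
pose ws s x v := sg * (ft s (x + d) v - ft s x v) - k / 2 * d * (l * expR (l * s)).
pose wx s x v := sg * (fx s (x + d) v - fx s x v).
pose wv s x v := sg * (fv s (x + d) v - fv s x v).
apply: (@transport_max_principle R t0 Q a (b - d) w ws wx wv (fun s x _ => E s x)) => //.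
- exact: ltW.
- apply: continuous_sub.
    apply: continuous_mul; first exact: continuous_cst.
    by apply: continuous_sub => //; exact: h.
  apply: continuous_mul; first exact: continuous_cst.
  move=> z; apply: (@continuous_comp _ _ _ (fun z : R * R * R => l * z.1.1) expR).
    by apply: continuous_mul => //; exact: continuous_cst.
  exact: continuous_expR.
- move=> s' x' v' _.
  exact: (is_derive1_sub (is_derive1_scale sg (is_derive1_sub (dt _ _ _) (dt _ _ _)))
    (is_derive1_scale (k / 2 * d) (is_derive_expR_linear l s'))).
- move=> s' x' v' [/andP[s0 s't] _ _]; have st' : 0 <= s' <= t0 by lra.
  have dxd : is_derive x' 1 (fun x => f s' (x + d) v') (fx s' (x' + d) v').
    apply: is_derive1_eq (is_derive1_chain (u := fun x => f s' x v')
      (is_derive1_add (is_derive1_idfun x') (is_derive1_const d x'))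
      (dx (x' + d) v' st')) _.
    by rewrite addr0 mulr1.
  rewrite /wx -[sg * _]subr0.
  exact: (is_derive1_sub (is_derive1_scale sg (is_derive1_sub dxd (dx x' v' st')))
    (is_derive1_const _ _)).
- move=> s' x' v' [/andP[s0 s't] _ _]; have st' : 0 <= s' <= t0 by lra.
  rewrite /wv -[sg * _]subr0.
  exact: (is_derive1_sub (is_derive1_scale _ (is_derive1_sub (dv _ _ st') (dv _ _ st')))
    (is_derive1_const _ _)).
- move=> s' x' v' [/andP[s0 s't] /andP[x1 x2] v'Q]; have st' : 0 <= s' <= t0 by lra.
  have Qs : 0 <= Q * s' by rewrite mulr_ge0// ltW.
  have e1 := vlasov x' v' st'; have e2 := vlasov (x' + d) v' st'.
  have -> : ws s' x' v' + v' * wx s' x' v' - E s' x' * wv s' x' v' =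
      sg * ((E s' (x' + d) - E s' x') * fv s' (x' + d) v')
      - k / 2 * d * (l * expR (l * s')).
    rewrite /ws /wx /wv.
    have -> : ft s' x' v' = E s' x' * fv s' x' v' - v' * fx s' x' v' by lra.
    have -> : ft s' (x' + d) v' =
      E s' (x' + d) * fv s' (x' + d) v' - v' * fx s' (x' + d) v' by lra.
    by ring.
  have x'b : a <= x' + d <= b by lra.
  have HL := fvL _ _ _ st' x'b (ltW v'Q).
  have HE : `|E s' (x' + d) - E s' x'| <= 2 * Q ^+ 2 * k / l * expR (l * s') * (x' + d - x').
    by apply: lipschitz_field => //; lra.
  rewrite subr_le0; apply: (le_trans (ler_norm _)).
  rewrite !normrM (_ : `|sg| = 1) ?mul1r; last by case: hsg => ->; rewrite ?normrN normr1.
  apply: (le_trans (ler_pM _ _ HE HL)) => //.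
  have -> : 2 * Q ^+ 2 * k / l * expR (l * s') * (x' + d - x') * L =
     k / 2 * d * (expR (l * s') * (4 * Q ^+ 2 * L / l)) by field; lra.
  have LL : 4 * Q ^+ 2 * L / l <= l.
    by rewrite ler_pdivrMr// (le_trans lL)// ler_peMl// ltW.
  rewrite [X in _ <= _ * X]mulrC; apply: ler_wpM2l.
    by rewrite !mulr_ge0// ltW.
  by rewrite ler_wpM2l// expR_ge0.
- move=> x' v' x'b; rewrite /w !init; [|lra|lra].
  by rewrite subrr mulr0 sub0r oppr_le0 !mulr_ge0 ?expR_ge0// ltW.
- move=> s' x' v' st' _ v'Q; rewrite /w !f_supp//.
  by rewrite subrr mulr0 sub0r oppr_le0 !mulr_ge0 ?expR_ge0// ltW.
- by rewrite ax/= /d; lra.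
Qed.

(** A first Lipschitz constant is a bound of fx on a compact box containing the
    trapezoid; halving it repeatedly leaves 0. *)
Lemma lipschitz0 : exists2 l, 0 < l & lipschitz_x 0 l.
Proof.
have [L L0 HL] := bounded_on_box 0 t0 a b (- Q) Q cfv.
have [M M0 HM] := bounded_on_box 0 t0 a b (- Q) Q cfx.
pose l := 1 + 4 * Q ^+ 2 * L.
have QL : 0 <= 4 * Q ^+ 2 * L by rewrite !mulr_ge0// ltW.
have l0 : 0 < l by rewrite /l; lra.
exists l => //.
have lipn n : lipschitz_x (M / 2 ^+ n) l.
  elim: n => [|n IH]; last first.
    rewrite (_ : M / 2 ^+ n.+1 = M / 2 ^+ n / 2); last by rewrite exprSr; field.
    apply: (@lipschitz_halving _ _ L) => //.
    - by rewrite divr_ge0// exprn_ge0.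
    - by rewrite /l; lra.
    - by rewrite /l; lra.
    - by move=> s x v ? ? ?; apply: HL => //; rewrite -ler_norml.
  move=> s x y v st ax xy yb; rewrite expr0 divr1.
  have /andP[s0 _] := st; have Qs : 0 <= Q * s by rewrite mulr_ge0// ltW.
  have yx : 0 <= y - x by rewrite subr_ge0.
  have ex : 1 <= expR (l * s) by rewrite -expR0 ler_expR mulr_ge0// ltW.
  have [vQ|vQ] := leP Q `|v|.
    by rewrite !f_supp// subrr normr0 !mulr_ge0// expR_ge0.
  have dd z := dx z v st.
  have [|c + ->] := @MVT_segment R _ (fun z => fx s z v) x y xy (fun z _ => dd z).
    exact: (continuous_subspaceT (is_derive_continuous dd)).
  rewrite in_itv/= => cxy; rewrite normrM [`|y - x|]ger0_norm//.
  rewrite ler_wpM2r//; apply: (@le_trans _ _ M); last by rewrite ler_peMr.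
  by apply: HM => //; [lra|rewrite -ler_norml ltW].
move=> s x y v st ax xy yb; rewrite !mul0r.
apply: (@le0_of_halving _ _ (M * expR (l * s) * (y - x))) => n.
rewrite (_ : _ / 2 ^+ n = M / 2 ^+ n * expR (l * s) * (y - x)); last by ring.
exact: lipn.
Qed.

Lemma f_const_trapezoid (s x y v : R) : 0 <= s <= t0 ->
  a + Q * s < x -> x <= y -> y < b - Q * s -> f s y v = f s x v.
Proof.
move=> st ax xy yb; have [l _ /(_ s x y v st ax xy yb)] := lipschitz0.
by rewrite !mul0r normr_le0 subr_eq0 => /eqP.
Qed.

Lemma E_const_trapezoid (s x y : R) : 0 <= s <= t0 ->
  a + Q * s < x -> x <= y -> y < b - Q * s -> E s y = E s x.
Proof.
move=> st ax xy yb; have [l l0 lip] := lipschitz0.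
have := lipschitz_field (lexx 0) l0 lip st ax xy yb.
by rewrite mulr0 !mul0r normr_le0 subr_eq0 => /eqP.
Qed.

(** The density does not depend on x, and its integral over a segment is an
    increment of E, hence 0. *)
Lemma density0_trapezoid (s x : R) : 0 <= s <= t0 ->
  a + Q * s < x < b - Q * s -> density s x = 0.
Proof.
move=> st /andP[ax xb]; pose y := (x + (b - Q * s)) / 2.
have xy : x < y by rewrite /y; lra.
have yb : y < b - Q * s by rewrite /y; lra.
have Eyx := E_const_trapezoid st ax (ltW xy) yb.
have := poisson st (ltW xy); rewrite Eyx subrr /total_charge.
have -> : \int[mu]_(z in `[x, y]) density s z = \int[mu]_(z in `[x, y]) density s x.
  apply: eq_Rintegral => z; rewrite inE/= in_itv/= => /andP[xz zy].
  by apply: eq_Rintegral => v _; rewrite (f_const_trapezoid v st ax)//; lra.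
rewrite Rintegral_cst//= lebesgue_measure_itv/= lte_fin xy/=.
move/esym/eqP; rewrite mulf_eq0 => /orP[/eqP//|].
by rewrite subr_eq0 => /eqP yx; move: xy; rewrite yx ltxx.
Qed.

End Trapezoid.
End Core.

(** * The field and the density outside the perturbed region *)

Lemma eq_Rintegral_set {R : realType} (D D' : set R) (rho : R -> R) :
  (forall y, D y -> ~ D' y -> rho y = 0) ->
  (forall y, D' y -> ~ D y -> rho y = 0) ->
  \int[@lebesgue_measure R]_(y in D) rho y = \int[@lebesgue_measure R]_(y in D') rho y.
Proof.
move=> h h'; rewrite [LHS]Rintegral_mkcond [RHS]Rintegral_mkcond.
congr Rintegral; apply/funext => y; rewrite !patchE.
have [yD|yD] := boolP (y \in D); have [yD'|yD'] := boolP (y \in D') => //.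
  by apply: h; [exact/set_mem|move/mem_set; apply/negP].
by apply/esym/h'; [exact/set_mem|move/mem_set; apply/negP].
Qed.

Lemma poisson_outside {R : realType} (rho : R -> R) (r x : R) : 0 <= r ->
  (forall y, r < `|y| -> rho y = 0) -> r < `|x| ->
  2^-1 * (\int[@lebesgue_measure R]_(y in `]-oo, x]) rho y -
          \int[@lebesgue_measure R]_(y in `[x, +oo[) rho y) =
  VP_sign x * (2^-1 * \int[@lebesgue_measure R]_(y in `[- r, r]) rho y).
Proof.
move=> r0 rho0 rx.
have out y : ~ (`[- r, r]%classic y) -> rho y = 0.
  move=> yr; apply: rho0; rewrite ltNge ler_norml; apply/negP => yr'.
  by apply: yr; rewrite /= in_itv.
rewrite /VP_sign; case: ifPn => [x0|]; last rewrite -ltNge => x0.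
  rewrite ger0_norm// in rx.
  rewrite (@eq_Rintegral_set _ `]-oo, x] `[- r, r]); last 2 first.
  - by move=> y _; exact: out.
  - move=> y /=; rewrite !in_itv/= => yr []; lra.
  rewrite (@eq_Rintegral_set _ `[x, +oo[ set0); last 2 first.
  - move=> y /=; rewrite !in_itv/= andbT => xy _; apply: rho0.
    by rewrite ger0_norm; lra.
  - by [].
  by rewrite Rintegral_set0 subr0 mul1r.
rewrite ltr0_norm// in rx.
rewrite (@eq_Rintegral_set _ `]-oo, x] set0); last 2 first.
- move=> y /=; rewrite !in_itv/= => xy _; apply: rho0.
  by rewrite ler0_norm; lra.
- by [].
rewrite (@eq_Rintegral_set _ `[x, +oo[ `[- r, r]); last 2 first.
- by move=> y _; exact: out.
- move=> y /=; rewrite !in_itv/= andbT => yr []; lra.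
by rewrite Rintegral_set0 sub0r mulrN mulN1r.
Qed.

Lemma poisson_increment {R : realType} (rho : R -> R) (x y : R) : x <= y ->
  (@lebesgue_measure R).-integrable setT (EFin \o rho) ->
  2^-1 * (\int[@lebesgue_measure R]_(z in `]-oo, y]) rho z -
          \int[@lebesgue_measure R]_(z in `[y, +oo[) rho z) -
  2^-1 * (\int[@lebesgue_measure R]_(z in `]-oo, x]) rho z -
          \int[@lebesgue_measure R]_(z in `[x, +oo[) rho z) =
  \int[@lebesgue_measure R]_(z in `[x, y]) rho z.
Proof.
move=> xy irho.
have iS (i : interval R) : (@lebesgue_measure R).-integrable [set` i] (EFin \o rho).
  exact: integrableS irho.
have := @Rintegral_itvB R rho -oo%O (BRight y) x (iS _) isT xy.
rewrite Rintegral_itv_obnd_cbnd//.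
have := @Rintegral_itvB R rho (BLeft x) +oo%O y (iS _) xy isT.
rewrite Rintegral_itv_obnd_cbnd//.
by lra.
Qed.

Lemma VP_sign_pos {R : realType} (x : R) : 0 <= x -> VP_sign x = 1.
Proof. by rewrite /VP_sign => ->. Qed.

Lemma VP_sign_neg {R : realType} (x : R) : x < 0 -> VP_sign x = - 1.
Proof. by rewrite /VP_sign leNgt => ->. Qed.

Section Far.
Context {R : realType}.
Local Notation mu := (@lebesgue_measure R).
Variables (t0 Q : R) (F F' : R -> R) (f ft fx fv : R -> R -> R -> R) (E : R -> R -> R)
  (R0 : R).
Hypothesis sol : confined_solution t0 Q F f ft fx fv E.
Hypothesis R0_ge0 : 0 <= R0.
Hypothesis F_supp : forall v, Q <= `|v| -> F v = 0.
Hypothesis dF : forall v : R, is_derive v 1 F (F' v).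
Hypothesis init : forall x v, R0 < `|x| -> f 0 x v = F v.
Hypothesis field : forall s x, 0 <= s <= t0 -> E s x =
  2^-1 * (\int[mu]_(y in `]-oo, x]) density Q F f s y -
          \int[mu]_(y in `[x, +oo[) density Q F f s y).

Local Notation density := (density Q F f).
Local Notation momentum := (momentum Q f).
Local Notation total_charge := (total_charge Q F f).

Let Q_gt0 := speed_gt0 sol.
Let t0_gt0 := horizon_gt0 sol.

(** The points x and y lie on the same side of the perturbation, so both belong
    to a trapezoid whose base avoids [- R0, R0]; h is half of the distance to the
    cone. *)
Lemma f_const_outside (s x y v : R) : 0 <= s <= t0 -> x <= y ->
  R0 + Q * s < x \/ y < - (R0 + Q * s) -> f s y v = f s x v.
Proof.
move=> st xy H; have /andP[s0 _] := st; have R00 := R0_ge0.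
have Qs : 0 <= Q * s by rewrite mulr_ge0// ltW.
case: H => H.
- pose h := (x - Q * s - R0) / 2.
  apply: (@f_const_trapezoid _ t0 Q F f ft fx fv E sol (x - Q * s - h) (y + Q * s + h)) => //.
  + move=> z w /andP[z1 z2]; apply: init; rewrite ger0_norm; rewrite /h in z1; lra.
  + by rewrite /h; lra.
  + by rewrite /h; lra.
- pose h := (- y - Q * s - R0) / 2.
  apply: (@f_const_trapezoid _ t0 Q F f ft fx fv E sol (x - Q * s - h) (y + Q * s + h)) => //.
  + move=> z w /andP[z1 z2]; apply: init; rewrite ler0_norm; rewrite /h in z2; lra.
  + by rewrite /h; lra.
  + by rewrite /h; lra.
Qed.

Lemma density0_outside (s x : R) : 0 <= s <= t0 -> R0 + Q * s < `|x| -> density s x = 0.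
Proof.
move=> st H; have /andP[s0 _] := st; have R00 := R0_ge0.
have Qs : 0 <= Q * s by rewrite mulr_ge0// ltW.
pose h := (`|x| - Q * s - R0) / 2.
apply: (@density0_trapezoid _ t0 Q F f ft fx fv E sol (x - Q * s - h) (x + Q * s + h)) => //.
  move=> z w /andP[z1 z2]; apply: init; rewrite /h in z1 z2.
  have [x0|x0] := leP 0 x.
    by rewrite (ger0_norm x0) in H z1 z2; rewrite ger0_norm; lra.
  by rewrite (ltr0_norm x0) in H z1 z2; rewrite ler0_norm; lra.
by rewrite /h; lra.
Qed.

Lemma field_outside (r s x : R) : 0 <= s <= t0 -> R0 + Q * s <= r -> r < `|x| ->
  E s x = VP_sign x * (2^-1 * total_charge (- r) r s).
Proof.
move=> st Rr rx; have /andP[s0 _] := st; have R00 := R0_ge0.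
have Qs : 0 <= Q * s by rewrite mulr_ge0// ltW.
rewrite field// (@poisson_outside _ _ r)//; first lra.
by move=> y ry; apply: density0_outside => //; lra.
Qed.

Definition mass := \int[mu]_(v in `[- Q, Q]) F v.

Let QQ : - Q <= Q. Proof. by move: Q_gt0; lra. Qed.

Let cvar (g : R -> R -> R -> R) (s x : R) :
  continuous (fun z : R * R * R => g z.1.1 z.1.2 z.2) -> continuous (g s x).
Proof.
by move=> cg; apply: (continuous_comp3 cg); [exact: continuous_cst|exact: continuous_cst|
  move=> z; exact: cvg_id].
Qed.

Lemma mass_outside (s x : R) : 0 <= s <= t0 -> R0 + Q * s < `|x| ->
  \int[mu]_(v in `[- Q, Q]) f s x v = mass.
Proof.
move=> st H; have := density0_outside st H; rewrite /density RintegralB//.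
- by move/eqP; rewrite subr_eq0 => /eqP.
- by apply: continuous_integrable_itv; exact: confined_continuous_bg sol.
- by apply: continuous_integrable_itv; exact: (@cvar f s x (confined_continuous sol)).
Qed.

(** Multiply the Vlasov equation by v and integrate: the x-derivative of f
    vanishes there, and an integration by parts turns v fv into - f, whose
    integral is the background mass since the density is 0. *)
Lemma momentum_rate_outside (s x : R) : 0 <= s <= t0 -> R0 + Q * s < `|x| ->
  \int[mu]_(v in `[- Q, Q]) (v * ft s x v) = - mass * E s x.
Proof.
move=> st H; have /andP[s0 _] := st; have R00 := R0_ge0.
have Qs : 0 <= Q * s by rewrite mulr_ge0// ltW.
have fx0 v : fx s x v = 0.
  pose h := (`|x| - R0 - Q * s) / 2.
  have h0 : 0 < h by rewrite /h; lra.
  apply: (derive_cst_itv (c := x) (d := x + h) (confined_dx sol x v st)).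
  - by lra.
  - by lra.
  - move=> z zx; apply: f_const_outside => //; first lra.
    have [x0|x0] := leP 0 x; [left|right].
      by rewrite (ger0_norm x0) in H; lra.
    by rewrite /h in zx h0; rewrite (ltr0_norm x0) in H zx h0; lra.
have cv : continuous (fun v : R => v) by move=> z; exact: cvg_id.
have cfv := @cvar fv s x (confined_continuous_v sol).
have cf := @cvar f s x (confined_continuous sol).
transitivity (\int[mu]_(v in `[- Q, Q]) (E s x * (v * fv s x v))).
  apply: eq_Rintegral => v _.
  by have := confined_vlasov sol x v st; rewrite fx0 mulr0 addr0 => /subr0_eq ->; ring.
rewrite RintegralZl//; last first.
  by apply: continuous_integrable_itv; exact: continuous_mul.
have cg : continuous (fun v => 1 * f s x v + v * fv s x v).
  apply: continuous_add; apply: continuous_mul => //; exact: continuous_cst.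
have := Rintegral_derive cg QQ (fun v =>
  is_derive1_mul (is_derive1_idfun v) (confined_dv sol x v st)).
rewrite RintegralD//; last 2 first.
- by apply: continuous_integrable_itv; apply: continuous_mul => //; exact: continuous_cst.
- by apply: continuous_integrable_itv; apply: continuous_mul.
have -> : \int[mu]_(v in `[- Q, Q]) (1 * f s x v) = mass.
  by rewrite -(mass_outside st H); apply: eq_Rintegral => v _; rewrite mul1r.
have fQ : f s x Q = 0 by apply: (confined_supp sol) => //; rewrite ger0_norm// ltW.
have fNQ : f s x (- Q) = 0.
  by apply: (confined_supp sol) => //; rewrite normrN ger0_norm// ltW.
rewrite fQ fNQ !mulr0 subrr => h.
by rewrite (_ : \int[mu]_(v in _) (v * fv s x v) = - mass); [ring|lra].
Qed.

Let E0 := 2^-1 * total_charge (- R0) R0 0.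

(** For r just outside the cone, e(s) = E(s, r) = - E(s, - r) is half of the
    charge of [- r, r].  Its rate q is half of a difference of two momenta, which
    themselves evolve at the rates - w^2 e and w^2 e. *)
Lemma field_oscillates (w s x : R) : w ^+ 2 = mass -> 0 <= s <= t0 ->
  R0 + Q * t0 < `|x| -> E s x = VP_sign x * (E0 * cos (w * s)).
Proof.
move=> w2 st H; have R00 := R0_ge0; have t00 := t0_gt0.
have Qt : 0 <= Q * t0 by rewrite mulr_ge0 ?ltW//; exact: Q_gt0.
pose r := (R0 + Q * t0 + `|x|) / 2.
have r1 : R0 + Q * t0 < r by rewrite /r; lra.
have r2 : r < `|x| by rewrite /r; lra.
have r0 : 0 < r by lra.
have rN : `|r| = r by rewrite gtr0_norm.
have NrN : `|- r| = r by rewrite normrN.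
have Qs z : 0 <= z <= t0 -> Q * z <= Q * t0.
  by move=> /andP[_ zt]; rewrite ler_wpM2l// ltW.
have rr : - r <= r by lra.
have [Er ENr] : (forall z, 0 <= z <= t0 -> E z r = 2^-1 * total_charge (- r) r z) /\
    (forall z, 0 <= z <= t0 -> E z (- r) = - (2^-1 * total_charge (- r) r z)).
  have h z : 0 <= z <= t0 -> E z r = 2^-1 * total_charge (- r) r z /\
      E z (- r) = - (2^-1 * total_charge (- r) r z).
    move=> zt; have Qz := Qs z zt.
    have := confined_poisson sol zt rr.
    rewrite (@field_outside (R0 + Q * t0) z r)//;
      [|lra|lra].
    rewrite (@field_outside (R0 + Q * t0) z (- r))//;
      [|lra|lra].
    by rewrite VP_sign_pos ?VP_sign_neg; lra.
  by split=> z /h[].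
pose e z := 2^-1 * total_charge (- r) r z.
pose q z := 2^-1 * (momentum z r - momentum z (- r)).
have de (z : R) := is_derive1_scale 2^-1 (is_derive_charge sol z rr).
have dq (z : R) := is_derive1_scale 2^-1 (is_derive1_sub
  (is_derive_momentum_t sol z r) (is_derive_momentum_t sol z (- r))).
have e0 : e 0 = E0.
  have zt : 0 <= (0 : R) <= t0 by lra.
  rewrite /e -Er// (@field_outside R0)//.
  - by rewrite VP_sign_pos ?mul1r// ltW.
  - by lra.
  - by rewrite rN; lra.
rewrite (@field_outside r)//; last first.
  by have := Qs s st; lra.
congr (_ * _); rewrite -e0.
apply: (@oscillator R t0 w e _ q _ de dq) => //.
- by move=> z zt; rewrite (charge_rateE sol).
- move=> z zt; have Qz := Qs z zt.
  rewrite !(momentum_rate_outside)//; [|lra|lra].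
  by rewrite Er// ENr// w2 /e; lra.
- rewrite /q (_ : momentum 0 r = momentum 0 (- r)) ?subrr ?mulr0//.
  by apply: eq_Rintegral => v _; rewrite !init//; lra.
Qed.

(** Both f and the shifted profile are transported by the field
    sg E0 cos(w s).  The profile is supported in |v| < Q + B rather than
    |v| < Q, which is why the trapezoid closes at speed Q + B. *)
Lemma transport_same_side (w B a b sg s y v : R) : w ^+ 2 = mass ->
  (forall z, 0 <= z <= t0 -> `|E0 * sinq w z| <= B) ->
  (forall y, a <= y <= b -> R0 + Q * t0 < `|y| /\ VP_sign y = sg) ->
  0 <= s <= t0 -> a + (Q + B) * s < y < b - (Q + B) * s ->
  f s y v = F (v + sg * (E0 * sinq w s)).
Proof.
move=> w2 HB Hab st yab.
have [R00 t00 Q0] := And3 R0_ge0 t0_gt0 Q_gt0.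
have Qt : 0 <= Q * t0 by rewrite mulr_ge0 ?ltW.
have B0 : 0 <= B.
  have zt : 0 <= (0 : R) <= t0 by lra.
  exact: (le_trans (normr_ge0 _) (HB 0 zt)).
have sg1 : `|sg| <= 1.
  have /andP[ya yb] := yab; have : 0 <= (Q + B) * s.
    by have /andP[? _] := st; rewrite mulr_ge0// addr_ge0// ltW.
  move=> QBs; have /Hab[_ <-] : a <= y <= b by lra.
  by rewrite /VP_sign; case: ifP => _; rewrite ?normrN normr1.
pose g s v := v + sg * (E0 * sinq w s).
have cF := confined_continuous_bg sol.
have cg : continuous (fun z : R * R * R => F (g z.1.1 z.2)).
  move=> z; apply: (@continuous_comp _ _ _ (fun z : R * R * R => g z.1.1 z.2) F);
    last exact: cF.
  apply: continuous_add; first exact: continuous_coord3.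
  apply: continuous_mul; first exact: continuous_cst.
  apply: continuous_mul; first exact: continuous_cst.
  move=> p; apply: (@continuous_comp _ _ _ (fun z : R * R * R => z.1.1) (sinq w)).
    exact: continuous_coord1.
  exact: (is_derive_continuous (is_derive_sinq w)).
have dgs (z p : R) : is_derive z 1 (fun z => F (g z p))
    (F' (g z p) * (sg * (E0 * cos (w * z)))).
  have h := is_derive1_add (is_derive1_const p z)
    (is_derive1_scale sg (is_derive1_scale E0 (is_derive_sinq w z))).
  apply: is_derive1_eq (is_derive1_chain (u := F) h (dF _)) _.
  by rewrite add0r.
have dgv (z p : R) : is_derive p 1 (fun p => F (g z p)) (F' (g z p)).
  have h := is_derive1_add (is_derive1_idfun p)
    (is_derive1_const (sg * (E0 * sinq w z)) p).
  apply: is_derive1_eq (is_derive1_chain (u := F) h (dF _)) _.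
  by rewrite addr0 mulr1.
suff H c : c = 1 \/ c = -1 -> c * (f s y v - F (g s v)) <= 0.
  have := H 1 (or_introl erefl); have := H (-1) (or_intror erefl).
  by rewrite -/(g s v); lra.
move=> _.
pose W z p q := c * (f z p q - F (g z q)).
apply: (@transport_max_principle R t0 (Q + B) a b W
  (fun z p q => c * (ft z p q - F' (g z q) * (sg * (E0 * cos (w * z)))))
  (fun z p q => c * fx z p q) (fun z p q => c * (fv z p q - F' (g z q)))
  (fun z p _ => E z p)) => //.
- by lra.
- apply: continuous_mul; first exact: continuous_cst.
  by apply: continuous_sub => //; exact: confined_continuous sol.
- move=> z p q _.
  exact: (is_derive1_scale c (is_derive1_sub (confined_dt sol z p q) (dgs z q))).
- move=> z p q [/andP[z0 zt] _ _]; have zt0 : 0 <= z <= t0 by lra.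
  rewrite -[fx z p q]subr0.
  exact: (is_derive1_scale c (is_derive1_sub (confined_dx sol p q zt0)
    (is_derive1_const (F (g z q)) p))).
- move=> z p q [/andP[z0 zt] _ _]; have zt0 : 0 <= z <= t0 by lra.
  exact: (is_derive1_scale c (is_derive1_sub (confined_dv sol p q zt0) (dgv z q))).
- move=> z p q [/andP[z0 zt] pab _]; have zt0 : 0 <= z <= t0 by lra.
  have QBz : 0 <= (Q + B) * z by rewrite mulr_ge0// ?addr_ge0// ltW.
  have /Hab[pout psg] : a <= p <= b by lra.
  have := confined_vlasov sol p q zt0.
  rewrite (field_oscillates w2 zt0 pout) psg => vl.
  rewrite (_ : _ - _ = c * (ft z p q + q * fx z p q
    - sg * (E0 * cos (w * z)) * fv z p q)); last by ring.
  by rewrite vl mulr0.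
- move=> p q /Hab[pout _]; rewrite /W /g sinq0 !mulr0 addr0 init ?subrr ?mulr0//.
  by lra.
- move=> z p q zt0 _ qQ; rewrite /W (confined_supp sol)//; last by lra.
  rewrite F_supp ?subrr ?mulr0// /g.
  have h : `|sg * (E0 * sinq w z)| <= B.
    by rewrite normrM -[B]mul1r ler_pM//; exact: HB.
  have := ler_normD (q + sg * (E0 * sinq w z)) (- (sg * (E0 * sinq w z))).
  by rewrite addrK normrN; lra.
Qed.

(** [transport_same_side] needs a trapezoid closing faster than Q, hence a point
    y far away; since f does not depend on x outside the cone, the value at y is
    the value at x. *)
Lemma distribution_oscillates (w s x v : R) : w ^+ 2 = mass -> 0 <= s <= t0 ->
  R0 + Q * t0 < `|x| -> f s x v = F (v + VP_sign x * (E0 * sinq w s)).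
Proof.
move=> w2 st xout; have [R00 t00 Q0] := And3 R0_ge0 t0_gt0 Q_gt0.
have Qt : 0 <= Q * t0 by rewrite mulr_ge0 ?ltW.
have csinq : continuous (fun z : R * R * R => E0 * sinq w z.1.1).
  apply: continuous_mul; first exact: continuous_cst.
  move=> p; apply: (@continuous_comp _ _ _ (fun z : R * R * R => z.1.1) (sinq w)).
    exact: continuous_coord1.
  exact: (is_derive_continuous (is_derive_sinq w)).
have [B B0 HB'] := @bounded_on_box R (fun z _ _ => E0 * sinq w z) 0 t0 0 0 0 0 csinq.
have HB z : 0 <= z <= t0 -> `|E0 * sinq w z| <= B.
  by move=> zt; apply: (HB' z 0 0); rewrite ?lexx.
have QB : 0 <= (Q + B) * t0 by apply: mulr_ge0; lra.
have QBs : (Q + B) * s <= (Q + B) * t0.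
  by have /andP[_ ?] := st; rewrite ler_wpM2l// addr_ge0// ltW.
have BQ : Q * t0 <= (Q + B) * t0 by apply: ler_wpM2r; lra.
have Qs : Q * s <= Q * t0 by have /andP[_ ?] := st; rewrite ler_wpM2l// ltW.
have x0 := normr_ge0 x.
(* y stays inside the trapezoid over [a, b] up to time t0, and y > |x| *)
pose a := R0 + 1 + (Q + B) * t0.
pose y := a + (Q + B) * t0 + `|x| + 1.
pose b := y + (Q + B) * t0 + 1.
have [xge|xlt] := leP 0 x.
- rewrite -(@f_const_outside s x y v st); first last.
  + by left; rewrite (ger0_norm xge) in xout; lra.
  + by rewrite /y /a; move: (ler_norm x); lra.
  rewrite VP_sign_pos//.
  apply: (@transport_same_side w B a b) => //.
    move=> z zab; have z0 : 0 <= z by rewrite /a in zab; lra.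
    by rewrite VP_sign_pos// ger0_norm//; split => //; rewrite /a in zab; lra.
  by rewrite /b /y /a; lra.
- rewrite (@f_const_outside s (- y) x v st); first last.
  + by right; rewrite (ltr0_norm xlt) in xout; lra.
  + by rewrite /y /a; move: (ler_norm (- x)); rewrite normrN; lra.
  rewrite VP_sign_neg//.
  apply: (@transport_same_side w B (- b) (- a)) => //.
    move=> z zab; have z0 : z < 0 by rewrite /a in zab; lra.
    by rewrite VP_sign_neg// ltr0_norm//; split => //; rewrite /a in zab; lra.
  by rewrite /b /y /a; lra.
Qed.

End Far.

(** * Reduction of a solution to a confined one *)

Lemma compactly_supported_bound {R : realType} (F : R -> R) :
  compactly_supported F -> exists M, forall v, M < `|v| -> F v = 0.
Proof.
move=> /compact_bounded[M [_ HM]]; exists (M + 1) => v Mv.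
apply/eqP; apply: contraT => Fv.
have vF : closure [set v | F v != 0] v by exact: subset_closure.
have := HM (M + 1); rewrite ltrDl ltr01 => /(_ isT v vF) /=.
by rewrite leNgt Mv.
Qed.

Lemma VP_radius_lower {R : realType} (R0 : R) (F : R -> R) (f : R -> R -> R -> R)
    (E : R -> R -> R) (t x : R) : 0 <= t ->
  (VP_radius R0 F f E t < `|x|%:E)%E -> (R0%:E + t%:E * Qg F f t < `|x|%:E)%E.
Proof.
move=> t0; apply: le_lt_trans; rewrite /VP_radius leeDl//.
apply: integral_ge0 => tau _; apply: integral_ge0 => s _.
apply: (@le_trans _ _ `|E s 0|%:E); first by rewrite lee_fin.
by apply: ereal_sup_ubound; exists 0.
Qed.

(** A finite radius at a positive time forces a finite velocity bound. *)
Lemma VP_radius_speed {R : realType} (R0 : R) (F : R -> R) (f : R -> R -> R -> R)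
    (E : R -> R -> R) (t x : R) : 0 < t ->
  (VP_radius R0 F f E t < `|x|%:E)%E ->
  exists q, [/\ 0 <= q, R0 + t * q < `|x| &
    forall tau y v, 0 <= tau <= t -> q < `|v| -> f tau y v = F v].
Proof.
move=> t0 /(VP_radius_lower (ltW t0)).
have Qg0 : (0 <= Qg F f t)%E by rewrite /Qg le_max lexx.
case EQ : (Qg F f t) Qg0 => [q| |] // q0.
- rewrite -EFinM -EFinD lte_fin => H; exists q; split => // tau y v taut qv.
  apply/eqP; rewrite eq_sym -subr_eq0; apply: contraT => gv.
  have : (`|v|%:E <= Qg F f t)%E.
    by rewrite /Qg le_max ereal_sup_ubound ?orbT//; exists v => //; exists y, tau.
  by rewrite EQ lee_fin leNgt qv.
- by rewrite mulry gtr0_sg// mul1e addey// ltNge leey.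
Qed.

Section Main.
Context {R : realType}.
Local Notation mu := (@lebesgue_measure R).
Variables (T : R) (F : R -> R) (f0 : R -> R -> R) (f : R -> R -> R -> R) (E : R -> R -> R)
  (R0 : R).
Hypothesis T_gt0 : 0 < T.
Hypothesis sol : VP_solution T F f0 f E.
Hypothesis R0_gt0 : 0 < R0.
Hypothesis init : forall x v, R0 < `|x| -> f0 x v = F v.
Hypothesis FC1 : C1 F.
Hypothesis Fsupp : compactly_supported F.
Hypothesis Feven : forall v, F (- v) = F v.

Let dF (v : R) : is_derive v 1 F (derive1 F v).
Proof. by rewrite derive1E; apply: derivableP; case: FC1. Qed.

Let cF : continuous F.
Proof. exact: is_derive_continuous dF. Qed.

Lemma field_initial (x : R) : R0 < `|x| -> E 0 x = VP_sign x * VP_E0 R0 F f0.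
Proof.
move=> xR; case: sol => _ [_ _ HE Hf0].
have z0 : 0 <= (0 : R) <= T by rewrite lexx ltW.
have rho0 y : R0 < `|y| -> VP_rho F f 0 y = 0.
  move=> yR; transitivity (\int[mu]_(v in setT) (0 : R)); last first.
    by rewrite /Rintegral integral0.
  by apply: eq_Rintegral => v _; rewrite Hf0 init// subrr.
rewrite HE// (poisson_outside (ltW R0_gt0) rho0 xR).
congr (_ * (_ * _)); apply: eq_Rintegral => y _.
by apply: eq_Rintegral => v _; rewrite Hf0.
Qed.

(** Near the velocity u the solution equals F at all times and positions, so
    only the term E F'(u) of the Vlasov equation is left. *)
Lemma field_vanishes (t q u : R) : 0 < t -> t <= T ->
  (forall tau y v, 0 <= tau <= t -> q < `|v| -> f tau y v = F v) ->
  q < `|u| -> derive1 F u != 0 -> forall s x, 0 <= s <= t -> E s x = 0.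
Proof.
move=> t0 tT fF qu F'u s x st.
have [[ft [fx [fv [C vlasov]]]] _] := sol.
have sT : 0 <= s <= T by lra.
have [fe [fte [fxe [fve [_ dte ext]]]]] := C1_slab_extension T_gt0 C.
have ft0 : ft s x u = 0.
  have [_ <- _ _] := ext s sT.
  apply: (derive_cst_itv (dte s x u) t0 st) => z zt.
  have zT : 0 <= z <= T by lra.
  have [-> _ _ _] := ext z zT; have [-> _ _ _] := ext s sT.
  by rewrite !fF.
have fx0 : fx s x u = 0.
  apply: (derive_cst_itv (c := x) (d := x + 1) (C1_slab_x C x u sT)); [lra|lra|].
  by move=> z _; rewrite !fF.
have fvF : fv s x u - derive1 F u = 0.
  have d := is_derive1_sub (C1_slab_v C x u sT) (dF u).
  have [u0|u0] := leP 0 u.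
    apply: (derive_cst_itv (c := u) (d := u + 1) d); [lra|lra|] => z zu.
    rewrite (ger0_norm u0) in qu.
    by rewrite !fF ?subrr//; rewrite ger0_norm; lra.
  apply: (derive_cst_itv (c := u - 1) (d := u) d); [lra|lra|] => z zu.
  rewrite (ltr0_norm u0) in qu.
  by rewrite !fF ?subrr//; rewrite ler0_norm; lra.
have := vlasov s x u sT; rewrite ft0 fx0 mulr0 addr0 sub0r => /eqP.
rewrite oppr_eq0 (subr0_eq fvF) mulf_eq0 (negbTE F'u) orbF.
by move/eqP.
Qed.

Lemma free_transport (t Q x v : R) : 0 < t -> t <= T -> 0 < Q ->
  (forall tau y v, 0 <= tau <= t -> Q <= `|v| -> f tau y v = F v) ->
  (forall s x, 0 <= s <= t -> E s x = 0) ->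
  R0 + Q * t < `|x| -> f t x v = F v.
Proof.
move=> t0 tT Q0 fF E0 H.
have [[ft [fx [fv [C vlasov]]]] [_ _ _ Hf0]] := sol.
have [fe [fte [fxe [fve [[cfe _ _ _] dte ext]]]]] := C1_slab_extension T_gt0 C.
have R00 := R0_gt0.
have tt : 0 <= t <= T by lra.
pose h := (`|x| - R0 - Q * t) / 2.
have h0 : 0 < h by rewrite /h; lra.
suff Hc c : c = 1 \/ c = -1 -> c * (fe t x v - F v) <= 0.
  have := Hc 1 (or_introl erefl); have := Hc (-1) (or_intror erefl).
  have [-> _ _ _] := ext t tt; lra.
move=> _.
apply: (@transport_max_principle R t Q (x - Q * t - h) (x + Q * t + h)
  (fun z p q => c * (fe z p q - F q)) (fun z p q => c * fte z p q)
  (fun z p q => c * fxe z p q) (fun z p q => c * (fve z p q - derive1 F q))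
  (fun _ _ _ => 0)).
- exact: ltW.
- apply: continuous_mul; first exact: continuous_cst.
  apply: continuous_sub => // z.
  by apply: (@continuous_comp _ _ _ (fun z : R * R * R => z.2) F); [exact: cvg_snd|exact: cF].
- move=> s p q _; rewrite -[fte s p q]subr0.
  exact: (is_derive1_scale c (is_derive1_sub (dte s p q) (is_derive1_const (F q) s))).
- move=> s p q [/andP[s0 st] _ _]; have sT : 0 <= s <= T by lra.
  rewrite -[fxe s p q]subr0; have [-> _ -> _] := ext s sT.
  exact: (is_derive1_scale c (is_derive1_sub (C1_slab_x C p q sT) (is_derive1_const (F q) p))).
- move=> s p q [/andP[s0 st] _ _]; have sT : 0 <= s <= T by lra.
  have [-> _ _ ->] := ext s sT.
  exact: (is_derive1_scale c (is_derive1_sub (C1_slab_v C p q sT) (dF q))).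
- move=> s p q [/andP[s0 st] _ _]; have sT : 0 <= s <= T by lra.
  have st0 : 0 <= s <= t by lra.
  have [_ -> -> _] := ext s sT; have := vlasov s p q sT.
  rewrite E0// mul0r subr0 => vl.
  by rewrite mul0r subr0 mulrCA -mulrDr vl mulr0.
- move=> p q pab; have [-> _ _ _] := ext 0 (introT andP (conj (lexx 0) (ltW T_gt0))).
  rewrite Hf0 init ?subrr ?mulr0//; rewrite /h in pab.
  have [x0|x0] := leP 0 x.
    by rewrite (ger0_norm x0) in H pab; rewrite ger0_norm; lra.
  by rewrite (ltr0_norm x0) in H pab; rewrite ler0_norm; lra.
- move=> s p q st _ Qq; have sT : 0 <= s <= T by lra.
  by have [-> _ _ _] := ext s sT; rewrite fF// subrr mulr0.
- by lra.
- by lra.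
Qed.

(** F is constant beyond q and compactly supported. *)
Lemma background_supp (q Q : R) : 0 <= q -> q < Q ->
  (forall u, q < `|u| -> derive1 F u = 0) -> forall v, Q <= `|v| -> F v = 0.
Proof.
move=> q0 qQ F'0.
have [M HM] := compactly_supported_bound Fsupp.
suff pos v : Q <= v -> F v = 0.
  move=> v; have [v0|v0] := leP 0 v; first by rewrite ger0_norm//; exact: pos.
  by rewrite ltr0_norm// => /pos; rewrite Feven.
move=> Qv; pose b := `|M| + v + 1.
have M0 := normr_ge0 M; have MM := ler_norm M.
have vb : v <= b <= b by rewrite /b; lra.
rewrite -(derive0_cst_itv dF _ vb).
  by apply: HM; rewrite ger0_norm /b; lra.
by move=> s sb; apply: F'0; rewrite ger0_norm; lra.
Qed.

Lemma confined_of_VP (t Q : R) : 0 < t -> t <= T -> 0 < Q ->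
  (forall tau y v, 0 <= tau <= t -> Q <= `|v| -> f tau y v = F v) ->
  (forall v, Q <= `|v| -> F v = 0) ->
  exists fe fte fxe fve : R -> R -> R -> R, [/\
    confined_solution t Q F fe fte fxe fve E,
    forall s, 0 <= s <= t -> fe s = f s &
    forall s, 0 <= s <= t -> density Q F fe s = VP_rho F f s].
Proof.
move=> t0 tT Q0 fF F0.
have [[ft [fx [fv [C vlasov]]]] [_ irho HE _]] := sol.
have [fe [fte [fxe [fve [[cfe cfte cfxe cfve] dte ext]]]]] := C1_slab_extension T_gt0 C.
have tT' s : 0 <= s <= t -> 0 <= s <= T by lra.
have rhoE s : 0 <= s <= t -> density Q F fe s = VP_rho F f s.
  move=> st; have [fes _ _ _] := ext s (tT' s st).
  apply/funext => y; rewrite /density fes.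
  apply: eq_Rintegral_set => [v _ []//|v _ vQ].
  rewrite fF ?subrr// leNgt ltr_norml; apply/negP => /andP[v1 v2].
  by apply: vQ; rewrite /= in_itv/=; lra.
exists fe, fte, fxe, fve; split => //; last first.
  by move=> s /tT'/ext[].
split => //.
- move=> s x v st; have [-> _ -> _] := ext s (tT' s st).
  exact: (C1_slab_x C x v (tT' s st)).
- move=> s x v st; have [-> _ _ ->] := ext s (tT' s st).
  exact: (C1_slab_v C x v (tT' s st)).
- move=> s x v st; have [_ -> -> ->] := ext s (tT' s st).
  exact: vlasov (tT' s st).
- move=> s x v st vQ; have [-> _ _ _] := ext s (tT' s st).
  by rewrite fF// F0.
- move=> s x y st xy; have sT := tT' s st.
  rewrite (HE s y sT) (HE s x sT) (poisson_increment xy (irho s sT)).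
  by rewrite /total_charge rhoE.
Qed.

End Main.

(** * Oscillation outside the perturbed region *)

Unset Implicit Arguments.

Theorem theorem2 (R : realType) (T : R) (F : R -> R) (f0 : R -> R -> R)
    (f : R -> R -> R -> R) (E : R -> R -> R) (R0 P Cst : R)
    (hT : 0 < T)
    (hsol : VP_solution T F f0 f E)
    (hR0 : 0 < R0)
    (hf0F : forall x v, R0 < `|x| -> f0 x v = F v)
    (hFC1 : C1 F)
    (hFsupp : compactly_supported F)
    (hFeven : forall v, F (- v) = F v)
    (hFnneg : forall v, 0 <= F v)
    (hf0C1 : C1_plane f0)
    (hf0nneg : forall x v, 0 <= f0 x v)
    (hP : 0 < P)
    (hf0supp : forall x v, P < `|v| -> f0 x v = 0)
    (hCst : 0 < Cst)
    (hE : (\int[@lebesgue_measure R]_(tau in `[0%R, T]) supnorm (E tau)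
             <= Cst%:E)%E) :
  forall t x v : R, 0 <= t <= T ->
    (VP_radius R0 F f E t < `|x|%:E)%E ->
    E t x = VP_E0 R0 F f0 * VP_sign x * cos (VP_omega F * t) /\
    f t x v = F (v + VP_E0 R0 F f0 * VP_sign x * sinq (VP_omega F) t).
Proof.
move=> t x v /andP[t0 tT] hx; have [_ [_ irho HE Hf0]] := hsol.
have E0x := field_initial hT hsol hR0 hf0F.
have [t_gt0|t_le0] := ltP 0 t; last first.
  have {t_le0} tE : t = 0 by apply/eqP; rewrite eq_le t_le0.
  subst t; have xR : R0 < `|x|.
    by move: (VP_radius_lower (lexx 0) hx); rewrite mul0e adde0 lte_fin.
  rewrite sinq0 !mulr0 cos0 mulr1 addr0 E0x// Hf0 hf0F//.
  by rewrite mulrC.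
have [q [q0 xq fq]] := VP_radius_speed t_gt0 hx.
(* strictly above q, so that f = F near |v| = Q, yet R0 + Q * t < |x| *)
pose Q := q + (`|x| - R0 - t * q) / (2 * t).
have qQ : q < Q by rewrite /Q ltrDl divr_gt0//; lra.
have Q0 : 0 < Q by lra.
have xQ : R0 + Q * t < `|x|.
  rewrite (_ : Q * t = t * q + (`|x| - R0 - t * q) / 2); first lra.
  by rewrite /Q; field; lra.
have fQ tau y u : 0 <= tau <= t -> Q <= `|u| -> f tau y u = F u.
  by move=> taut Qu; apply: fq => //; lra.
have tt : 0 <= t <= t by lra.
have [[u [qu F'u]]|noF'] := pselect (exists u, q < `|u| /\ derive1 F u != 0).
  have Evan := field_vanishes hT hsol hFC1 t_gt0 tT fq qu F'u.
  have VE0 : VP_E0 R0 F f0 = 0.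
    have /E0x : R0 < `|R0 + 1| by rewrite ger0_norm; lra.
    rewrite Evan; last by lra.
    by rewrite VP_sign_pos ?mul1r//; lra.
  rewrite VE0 !mul0r addr0 Evan//; split => //.
  exact: (free_transport hT hsol hR0 hf0F hFC1 v t_gt0 tT Q0 fQ Evan xQ).
have F'0 u : q < `|u| -> derive1 F u = 0.
  by move=> qu; apply/eqP; apply: contraT => F'u; exfalso; apply: noF'; exists u.
have F0 := background_supp hFC1 hFsupp hFeven q0 qQ F'0.
have [fe [fte [fxe [fve [sol feE rhoE]]]]] := confined_of_VP hT hsol hFC1 t_gt0 tT Q0 fQ F0.
have init y w : R0 < `|y| -> fe 0 y w = F w.
  by move=> yR; rewrite feE ?lexx ?ltW// Hf0 hf0F.
have field s y : 0 <= s <= t -> E s y =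
    2^-1 * (\int[@lebesgue_measure R]_(z in `]-oo, y]) density Q F fe s z -
            \int[@lebesgue_measure R]_(z in `[y, +oo[) density Q F fe s z).
  move=> st; have sT : 0 <= s <= T by lra.
  by rewrite (rhoE s st) (HE s y sT).
have dF (w : R) : is_derive w 1 F (derive1 F w).
  by rewrite derive1E; apply: derivableP; case: hFC1.
have massE : VP_omega F ^+ 2 = mass Q F.
  rewrite /VP_omega sqr_sqrtr; last by apply: Rintegral_ge0.
  apply: eq_Rintegral_set => [w _ wQ|w _ []//].
  apply: F0; rewrite leNgt ltr_norml; apply/negP => /andP[w1 w2].
  by apply: wQ; rewrite /= in_itv/=; lra.
have E0E : VP_E0 R0 F f0 = 2^-1 * total_charge Q F fe (- R0) R0 0.
  have zt : 0 <= (0 : R) <= t by lra.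
  rewrite /total_charge (rhoE 0 zt); congr (_ * _); apply: eq_Rintegral => z _.
  by apply: eq_Rintegral => w _; rewrite Hf0.
have R00 := ltW hR0.
rewrite E0E; split.
  rewrite (field_oscillates sol R00 init field massE tt xQ).
  by ring.
rewrite -feE// (distribution_oscillates sol R00 F0 dF init field v massE tt xQ).
by congr F; ring.
Qed.
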